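(* Let $(S,\mathcal{B})$ be a standard Borel space and let $X=(X_1,X_2,\ldots)$ be a sequence of $S$-valued random variables on a probability space $(\Omega,\mathcal{A},P)$, with predictive distributions $\alpha_n$, $n\ge 0$. Then the following two conditions are equivalent: (a) for each $f\in M_b(S)$, the sequence $\alpha_n(f)$ converges in probability as $n\to\infty$; (b) $\lim_n P(X_n\in B)$ exists for every $B\in\mathcal{B}$, and there is a random probability measure $\alpha$ on $\mathcal{B}$ such that $X_n$ converges stably to $\alpha$ and $$E\bigl\{\alpha(f)^2\bigr\}=\lim_n E\bigl\{\alpha_n(f)^2\bigr\}\quad\text{for all }f\in C_b(S).$$
   Context: A standard Borel space $(S,\mathcal{B})$ here means that $S$ is a Borel subset of some Polish space and $\mathcal{B}$ is the Borel $\sigma$-field on $S$. $M_b(S)$ is the set of real bounded $\mathcal{B}$-measurable functions on $S$ and $C_b(S)$ the set of real bounded continuous functions on $S$. Set $\mathcal{F}_0=\{\emptyset,\Omega\}$ and $\mathcal{F}_n=\sigma(X_1,\ldots,X_n)$ for $n\ge 1$. A random probability measure on $\mathcal{B}$ is a map $\alpha$ on $\Omega\times\mathcal{B}$ such that $\alpha(\omega,\cdot)$ is a probability measure on $\mathcal{B}$ for each fixed $\omega\in\Omega$, and $\omega\mapsto\alpha(\omega,B)$ is $\mathcal{A}$-measurable for each fixed $B\in\mathcal{B}$. For $f\in M_b(S)$, $\alpha(f)$ denotes the real random variable $\omega\mapsto\int f(x)\,\alpha(\omega,dx)$. The predictive distributions of $X$ are the random probability measures $\alpha_n(\cdot)=P(X_{n+1}\in\cdot\mid\mathcal{F}_n)$,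 $n\ge 0$ (regular conditional distributions), so that $\alpha_n(f)=E\{f(X_{n+1})\mid\mathcal{F}_n\}$ a.s. for each $f\in M_b(S)$. Let $\mathcal{A}^+=\{A\in\mathcal{A}:P(A)>0\}$, and for $H\in\mathcal{A}^+$ and a bounded random variable $Y$ let $E\{Y\mid H\}=E\{1_H Y\}/P(H)$. $X_n$ converges stably to a random probability measure $\alpha$ if $\lim_n E\{f(X_n)\mid H\}=E\{\alpha(f)\mid H\}$ for all $f\in C_b(S)$ and all $H\in\mathcal{A}^+$. *)

(* Defs.v *)
From HB Require Import structures.
From mathcomp Require Import all_boot all_order all_algebra.
From mathcomp Require Import all_classical all_reals all_analysis.

Set Implicit Arguments.
Unset Strict Implicit.
Unset Printing Implicit Defensive.

Import Order.TTheory GRing.Theory Num.Theory.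
Import numFieldNormedType.Exports.

Local Open Scope classical_set_scope.
Local Open Scope ring_scope.

#[short(type="completeMetricType")]
HB.structure Definition CompleteMetric (K : numDomainType) :=
  {T of Metric K T & Complete T}.

Definition homeomorphic (T U : topologicalType) : Prop :=
  exists f : T -> U, exists g : U -> T,
    [/\ continuous f, continuous g, cancel f g & cancel g f].

Definition separable_space (T : topologicalType) : Prop :=
  exists2 D : set T, countable D & dense D.

(* Complete types are pointed, so the empty space is not counted as Polish;
   every space below is nonempty. *)
Definition polish_space (R : realType) (T : topologicalType) : Prop :=
  separable_space T /\ exists M : completeMetricType R, homeomorphic T M.

Notation borel T := (g_sigma_algebraType (@open T)).

(* [A : set E] is coerced to the type of its elements, which carries the
   subspace topology. *)
Definition standard_borel_space (R : realType) (S : topologicalType) : Prop :=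
  exists (E : topologicalType) (A : set E),
    [/\ polish_space R E, <<s @open E >> A & homeomorphic S A].

Section random_elements.
Context {R : realType} {d d' : measure_display}.
Context {Omega : measurableType d} {T : measurableType d'}.
Variable P : probability Omega R.

(* Sequences are indexed from 0: [X i] is the variable usually written
   X_{i+1}, so that [natural_filtration X n] is generated by the first n
   variables; for n = 0 it is {set0, setT}. *)
Definition natural_filtration (X : nat -> Omega -> T) (n : nat) :
    set (set Omega) :=
  <<s \bigcup_(i < n) g_sigma_algebra_preimage (X i) >>.

Definition is_cond_expectation (G : set (set Omega)) (Y Z : Omega -> R) : Prop :=
  [/\ P.-integrable setT (EFin \o Z),
      measurable_fun setT (Z : g_sigma_algebraType G -> R) &
      forall A, G A ->
        (\int[P]_(w in A) (Z w)%:E = \int[P]_(w in A) (Y w)%:E)%E].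

(* [X n] is the (n+1)-st variable: the n-th predictive distribution is its
   regular conditional distribution given the first n variables. *)
Definition predictive_distributions (X : nat -> {RV P >-> T})
    (alpha_ : nat -> R.-pker Omega ~> T) : Prop :=
  forall n (B : set T), measurable B ->
    is_cond_expectation (natural_filtration X n)
      (\1_(X n @^-1` B)) (fun w => fine (alpha_ n w B)).

Definition kernel_mean (alpha : R.-pker Omega ~> T) (f : T -> R) : Omega -> R :=
  fun w => \int[alpha w]_x f x.

Definition cvg_in_probability (Z : nat -> Omega -> R) (V : {RV P >-> R}) : Prop :=
  forall e : R, 0 < e ->
    P [set w | e < `|Z n w - V w|] @[n --> \oo] --> 0%E.

Definition expectation_given (H : set Omega) (Y : Omega -> R) : R :=
  fine 'E_P[(fun w => \1_H w * Y w)%R] / fine (P H).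

End random_elements.

Definition cvg_stably {R : realType} {S : ptopologicalType}
    {d : measure_display} {Omega : measurableType d} (P : probability Omega R)
    (X : nat -> {RV P >-> borel S}) (alpha : R.-pker Omega ~> borel S) : Prop :=
  forall f : S -> R, continuous f -> bounded_fun f ->
  forall H : set Omega, measurable H -> (0 < P H)%E ->
    expectation_given P H (fun w => f (X n w)) @[n --> \oo]
      --> expectation_given P H (kernel_mean alpha f).

(* Main.v *)
Require Import Defs.
From HB Require Import structures.
From mathcomp Require Import all_boot all_order all_algebra.
From mathcomp Require Import all_classical all_reals all_analysis.
From mathcomp Require Import measurable_realfun.
From mathcomp Require Import ring lra.

Set Implicit Arguments.
Unset Strict Implicit.
Unset Printing Implicit Defensive.

Import Order.TTheory GRing.Theory Num.Theory.
Import numFieldNormedType.Exports.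

Local Open Scope classical_set_scope.
Local Open Scope ring_scope.

(* Write alpha_n(f) for the mean of f under the n-th predictive law.  The
   variables f(X_{n+1}) - alpha_n(f) are bounded and orthogonal, so by Bessel's
   inequality their correlations with any bounded Z tend to 0: stable
   convergence of X_n to alpha means that alpha_n(f) tends to alpha(f) weakly in
   L2 for continuous f.  Both conditions turn out to be equivalent to the
   existence of a kernel alpha such that alpha_n(B) tends to alpha(B) in L1 for
   every Borel set B.

   From (b), convergence of the norms upgrades weak to strong L2 convergence for
   continuous f.  To reach Borel sets one approximates them by continuous
   functions, uniformly in n along the laws of the X_n; this is possible because
   a setwise convergent sequence of probabilities is uniformly countably
   additive (Nikodym).

   From (a), the point is to build alpha.  A standard Borel space is a measurable
   retract of the real line, so the limits of alpha_n on the preimages of the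
   rays with rational endpoints give a random distribution function; alpha is the
   law of its quantile function at a uniform variable, transported back to S.
   Nikodym's theorem makes the sets B with alpha_n(B) -> alpha(B) a Dynkin
   class. *)

(** * Bounded measurable functions *)

(** Condition (b) tests stability and norms only against continuous functions. The bridge to all of
    [M_b(S)] is that the law of X_{n+1} is the mean of alpha_n: an estimate on the laws becomes an
    L1 estimate on the nonnegative variables alpha_n(B). From (a), the obstacle is that each limit
    of alpha_n(B) is fixed only up to a null set, so that the limits are monotone and additive in B
    only almost surely. No null set is discarded. The quantile is defined at every point from
    arbitrary versions F_i of the limits at the levels q_i: it lies below t when u <= F_i for some
    admissible q_i < t, an event whose mass is the supremum of these F_i. For nested rays the
    predictive mass of a finite union is a maximum, and maxima commute with L1 limits; with uniform
    countable additivity, the supremum is therefore the L1 limit for the ray below t. *)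

Definition bmf d (T : measurableType d) (R : realType) (f : T -> R) :=
  measurable_fun [set: T] f /\ exists K, forall x, `|f x| <= K.

Section bmf.
Context d (T : measurableType d) (R : realType).
Implicit Types f g : T -> R.

Lemma bmfP f : measurable_fun [set: T] f -> bounded_fun f -> bmf f.
Proof.
move=> mf [M [_ Mf]]; split => //; exists (M + 1) => x.
by apply: (Mf (M + 1)) => //; rewrite ltrDl.
Qed.

Lemma bmf_bounded f : bmf f -> bounded_fun f.
Proof.
move=> [mf [K fK]]; exists K; split; first exact: num_real.
by move=> M KM x _ /=; rewrite (le_trans (fK x)) ?ltW.
Qed.

Lemma bmf_cst (c : R) : bmf (fun _ : T => c).
Proof. by split; [exact: measurable_cst|exists `|c|]. Qed.

Lemma bmfD f g : bmf f -> bmf g -> bmf (fun x => f x + g x).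
Proof.
move=> [mf [K fK]] [mg [L gL]]; split; first exact: measurable_funD.
by exists (K + L) => x; rewrite (le_trans (ler_normD _ _)) ?lerD.
Qed.

Lemma bmfM f g : bmf f -> bmf g -> bmf (fun x => f x * g x).
Proof.
move=> [mf [K fK]] [mg [L gL]]; split; first exact: measurable_funM.
by exists (K * L) => x; rewrite normrM ler_pM.
Qed.

Lemma bmfZ c f : bmf f -> bmf (fun x => c * f x).
Proof. by move=> bf; apply: bmfM => //; exact: bmf_cst. Qed.

Lemma bmfB f g : bmf f -> bmf g -> bmf (fun x => f x - g x).
Proof.
move=> bf bg; have := bmfD bf (bmfZ (-1) bg).
by under [X in bmf X]eq_fun do rewrite mulN1r.
Qed.

Lemma bmf_norm f : bmf f -> bmf (fun x => `|f x|).
Proof.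
move=> [mf [K fK]]; split; first exact: measurableT_comp.
by exists K => x; rewrite normr_id.
Qed.

Lemma bmf_sqr f : bmf f -> bmf (fun x => f x ^+ 2).
Proof. by move=> bf; have := bmfM bf bf. Qed.

Lemma bmf_indic (A : set T) : measurable A -> bmf (\1_A : T -> R).
Proof.
move=> mA; split; first exact: measurable_indic.
by exists 1 => x; rewrite indicE; case: (_ \in _); rewrite /= ?normr1 ?normr0.
Qed.

Lemma bmf_sum (F : nat -> T -> R) (n : nat) : (forall i, bmf (F i)) ->
  bmf (fun x => \sum_(i < n) F i x).
Proof.
move=> bF; elim: n => [|n IHn].
  under [X in bmf X]eq_fun do rewrite big_ord0.
  exact: bmf_cst.
under [X in bmf X]eq_fun do rewrite big_ord_recr /=.
exact: bmfD.
Qed.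

End bmf.

Lemma bmf_comp d (T : measurableType d) d' (U : measurableType d')
  (R : realType) (f : U -> R) (h : T -> U) :
  bmf f -> measurable_fun setT h -> bmf (f \o h).
Proof.
by move=> [mf [K fK]] mh; split; [exact: measurableT_comp|exists K => x /=].
Qed.

(** The sum counts the positive multiples of [e] up to [y], at most [N] of them: it rounds [y] down
    to the grid of step [e] and caps the result at [N * e]. *)
Lemma staircaseP (R : realType) (e y : R) (N : nat) : 0 < e -> 0 <= y ->
  let s := \sum_(j < N) e * (j.+1%:R * e <= y)%R%:R in
  (y < N%:R * e /\ 0 <= y - s < e) \/ (N%:R * e <= y /\ s = N%:R * e).
Proof.
move=> e0 y0 /=; elim: N => [|N]; first by right; rewrite big_ord0 mul0r.
rewrite big_ord_recr /=; set s := (\sum_(i < N) _).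
have -> : N.+1%:R * e = N%:R * e + e by rewrite -natr1 mulrDl mul1r.
move=> [[yN sy]|[Ny sN]].
  have -> : (N%:R * e + e <= y) = false by apply/negP; lra.
  by rewrite /= mulr0 addr0; left; split => //; lra.
have [H|H] := leP (N%:R * e + e) y; rewrite /= ?mulr1 ?mulr0 ?addr0 sN.
  by right.
by left; split => //; lra.
Qed.

(** Closure is asked under uniform rather than monotone limits because the properties proved this
    way concern means, which are Lipschitz for the sup norm. The approximants come from rounding
    [f + K] down to multiples of [e]. *)
Lemma bmf_ind d (T : measurableType d) (R : realType) (Phi : (T -> R) -> Prop) :
  (forall A, measurable A -> Phi \1_A) ->
  (forall c f, bmf f -> Phi f -> Phi (fun x => c * f x)) ->
  (forall f g, bmf f -> bmf g -> Phi f -> Phi g -> Phi (fun x => f x + g x)) ->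
  (forall f, bmf f -> (forall e : R, 0 < e -> exists g, [/\ bmf g, Phi g &
     forall x, `|f x - g x| <= e]) -> Phi f) ->
  forall f, bmf f -> Phi f.
Proof.
move=> Phi1 PhiZ PhiD Philim f bf; apply: (Philim _ bf) => e e0.
have [mf [K fK]] := bf.
pose A j := [set x | j.+1%:R * e <= f x + K].
have mA j : measurable (A j).
  have -> : A j = setT `&` f @^-1` `[j.+1%:R * e - K, +oo[.
    by rewrite setTI; apply/seteqP; split => x /=; rewrite in_itv/= andbT lerBlDr.
  exact: mf.
pose s N x := \sum_(j < N) e * \1_(A j) x.
have bA j : bmf (fun x => e * \1_(A j) x) by exact: (bmfZ e (bmf_indic R (mA j))).
have bs N : bmf (s N) := bmf_sum N bA.
have Phis N : Phi (s N).
  elim: N => [|N IHN].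
    have -> : s 0%N = (fun x => 0 * \1_setT x).
      by apply/funext => x; rewrite /s big_ord0 mul0r.
    by apply: (PhiZ 0 \1_setT); [exact: bmf_indic|exact: Phi1].
  have -> : s N.+1 = (fun x => s N x + e * \1_(A N) x).
    by apply/funext => x; rewrite /s big_ord_recr.
  apply: PhiD => //.
  by apply: (PhiZ e \1_(A N)); [exact: bmf_indic|exact: Phi1].
(* Since [f + K] is at most [2 * K < N * e], the capped alternative of [staircaseP] cannot occur. *)
pose N := (Num.truncn ((2 * K) / e)).+1.
have K0 x : 0 <= f x + K.
  have := fK x; have := ler_norm (- f x); rewrite normrN; lra.
have bT : bmf (fun x : T => (- K) * \1_setT x).
  by apply: bmfZ; exact: bmf_indic.
exists (fun x => s N x + (- K) * \1_setT x); split.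
- exact: bmfD.
- apply: PhiD => //.
  by apply: (PhiZ _ \1_setT); [exact: bmf_indic|exact: Phi1].
- move=> x; have := staircaseP N e0 (K0 x) => /=.
  have -> : \sum_(j < N) e * (j.+1%:R * e <= f x + K)%R%:R = s N x.
    apply: eq_bigr => j _; rewrite indicE /A; congr (_ * _%:R).
    by rewrite mem_setE.
  have KN : 2 * K < N%:R * e by rewrite -ltr_pdivrMr// /N truncnS_gt.
  rewrite indicE in_setT/= mulr1.
  case => [[_ sN]|[H _]].
    by rewrite ler_norml; apply/andP; split; lra.
  by have := le_trans (ler_norm _) (fK x); lra.
Qed.

Section mean.
Context d (T : measurableType d) (R : realType).
Variables (mu : {measure set T -> \bar R}) (mu1 : mu setT = 1%E).
Implicit Types f g : T -> R.

Lemma bmf_integrable f : bmf f -> mu.-integrable setT (EFin \o f).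
Proof.
move=> bf; apply: measurable_bounded_integrable => //.
- by rewrite mu1 ltey.
- by case: bf.
- exact: bmf_bounded.
Qed.

Lemma meanD f g : bmf f -> bmf g ->
  \int[mu]_x (f x + g x) = \int[mu]_x f x + \int[mu]_x g x.
Proof. by move=> *; rewrite RintegralD//; exact: bmf_integrable. Qed.

Lemma meanB f g : bmf f -> bmf g ->
  \int[mu]_x (f x - g x) = \int[mu]_x f x - \int[mu]_x g x.
Proof. by move=> *; rewrite RintegralB//; exact: bmf_integrable. Qed.

Lemma meanZ c f : bmf f -> \int[mu]_x (c * f x) = c * \int[mu]_x f x.
Proof. by move=> *; rewrite RintegralZl//; exact: bmf_integrable. Qed.

Lemma mean_cst (c : R) : \int[mu]_x c = c.
Proof. by rewrite Rintegral_cst// mu1 mulr1. Qed.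

Lemma mean_indic A : measurable A -> \int[mu]_x \1_A x = fine (mu A).
Proof. by move=> mA; rewrite /Rintegral integral_indic// setIT. Qed.

Lemma le_mean f g : bmf f -> bmf g -> (forall x, f x <= g x) ->
  \int[mu]_x f x <= \int[mu]_x g x.
Proof. by move=> *; apply: le_Rintegral => //; exact: bmf_integrable. Qed.

Lemma mean_ge0 f : (forall x, 0 <= f x) -> 0 <= \int[mu]_x f x.
Proof. by move=> f0; exact: Rintegral_ge0. Qed.

Lemma norm_mean_le f : bmf f -> `|\int[mu]_x f x| <= \int[mu]_x `|f x|.
Proof. by move=> bf; apply: le_normr_Rintegral => //; exact: bmf_integrable. Qed.

Lemma mean_EFin f : bmf f -> (\int[mu]_x f x)%:E = (\int[mu]_x (f x)%:E)%E.
Proof.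
move=> bf; rewrite /Rintegral fineK//.
exact: (integrable_fin_num _ (bmf_integrable bf)).
Qed.

End mean.

Ltac bmf_tac := solve [repeat first [by [] | exact: bmf_cst | exact: bmf_indic |
  apply: bmf_norm | apply: bmf_sqr | apply: bmfB | apply: bmfD | apply: bmfM]].

(** * Nikodym's convergence theorem *)

Section fine_measure.
Context d (T : measurableType d) (R : realType).
Variables (mu : {measure set T -> \bar R}) (mu1 : mu setT = 1%E).

Lemma prob_fin_num A : measurable A -> mu A \is a fin_num.
Proof.
move=> mA; rewrite ge0_fin_numE// (@le_lt_trans _ _ (mu setT))//.
  by rewrite le_measure ?inE.
by rewrite mu1 ltey.
Qed.

Lemma fine_measureU A B : measurable A -> measurable B -> A `&` B = set0 ->
  fine (mu (A `|` B)) = fine (mu A) + fine (mu B).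
Proof. by move=> mA mB AB; rewrite measureU// fineD ?prob_fin_num. Qed.

Lemma fine_le_measure A B : measurable A -> measurable B -> A `<=` B ->
  fine (mu A) <= fine (mu B).
Proof. by move=> mA mB AB; rewrite fine_le ?prob_fin_num// le_measure ?inE. Qed.

Lemma fine_measureU_le A B : measurable A -> measurable B ->
  fine (mu (A `|` B)) <= fine (mu A) + fine (mu B).
Proof.
move=> mA mB; rewrite -fineD ?prob_fin_num// fine_le ?prob_fin_num//.
- exact: measurableU.
- by rewrite fin_numD !prob_fin_num.
- exact: measureU2.
Qed.

Lemma fine_measureD A B : measurable A -> measurable B -> B `<=` A ->
  fine (mu (A `\` B)) = fine (mu A) - fine (mu B).
Proof.
move=> mA mB BA; rewrite -[in RHS](setDUK BA) fine_measureU//.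
- by rewrite addrAC subrr add0r.
- exact: measurableD.
- by rewrite setDIK.
Qed.

Lemma fine_cvg_measure0 (B : nat -> set T) : (forall k, measurable (B k)) ->
  (forall k, B k.+1 `<=` B k) -> \bigcap_k B k = set0 ->
  fine (mu (B k)) @[k --> \oo] --> (0 : R).
Proof.
move=> mB Bd B0; suff /fine_cvgP[] : mu (B k) @[k --> \oo] --> 0%:E by [].
have <- : mu (\bigcap_k B k) = 0%:E by rewrite B0 measure0.
apply: nonincreasing_cvg_mu => //.
- by rewrite -ge0_fin_numE// prob_fin_num.
- by rewrite B0.
- apply/nonincreasing_seqP => n; exact/subsetPset.
Qed.

End fine_measure.

(* The gliding hump argument. *)
Lemma nikodym_convergence d (T : measurableType d) (R : realType)
    (mu : nat -> {measure set T -> \bar R}) (m : set T -> R)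
    (B : nat -> set T) (e : R) :
  (forall n, mu n setT = 1%E) ->
  (forall A, measurable A -> fine (mu n A) @[n --> \oo] --> m A) ->
  (forall k, measurable (B k)) -> (forall k, B k.+1 `<=` B k) ->
  \bigcap_k B k = set0 -> 0 < e ->
  exists k, \forall n \near \oo, fine (mu n (B k)) <= e.
Proof.
move=> mu1 mum mB Bd B0 e0; apply: contrapT => /forallNP Bbig.
pose q n A := fine (mu n A).
(* Of ten units the hump loses three to approximation errors, leaving the seven of [low], while the
   upper bound at the end allows an excess of only three. *)
pose e' := e / 10; have e'0 : 0 < e' by rewrite divr_gt0.
have ee' : e = 10 * e' by rewrite /e' mulrC divfK.
have Bmono i j : (i <= j)%N -> B j `<=` B i.
  move=> ij; have /nonincreasing_seqP : forall k, (B k >= B k.+1)%O.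
    by move=> k; exact/subsetPset.
  by move=> /(_ _ _ ij)/subsetPset.
have near A : measurable A -> exists N, forall n, (N <= n)%N -> `|m A - q n A| < e'.
  by move=> mA; have /cvgrPdist_lt/(_ _ e'0)[N _ HN] := mum _ mA; exists N.
have small n k : exists2 k', (k <= k')%N & q n (B k') < e'.
  have /cvgrPdist_lt/(_ _ e'0)[N _ HN] := fine_cvg_measure0 (mu1 n) mB Bd B0.
  exists (maxn N k); first exact: leq_maxr.
  have := HN (maxn N k) (leq_maxl _ _) => /=.
  by rewrite sub0r normrN; apply: le_lt_trans; exact: ler_norm.
have large k N : exists2 n, (N <= n)%N & e < q n (B k).
  apply: contrapT => /forall2NP H; apply: (Bbig k); exists N => // n /= Nn.
  by have [//|] := H n; move/negP; rewrite -leNgt.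
pose F' k F k1 := F `|` (B k `\` B k1).
(* The state is (j, (k, F)): stage, current index, set built so far; the output is ((n, n'), (k1,
   k2)). At time [n] the part of [B k] outside [B k1] has mass above [e - e'], and it is added to
   [F]; at time [n'] the tail [B k2], which will contain all later additions, is negligible. A
   nonmeasurable [F] gets arbitrary values, only to make the choice function total. *)
have step (x : nat * (nat * set T)) : exists y : (nat * nat) * (nat * nat),
    measurable x.2.2 ->
    [/\ (x.1 <= y.1.1)%N /\ (x.1 <= y.1.2)%N,
      (x.2.1 <= y.2.1)%N /\ (y.2.1 <= y.2.2)%N,
      e < q y.1.1 (B x.2.1) /\ q y.1.1 (B y.2.1) < e',
      `|m x.2.2 - q y.1.1 x.2.2| < e' &
      q y.1.2 (B y.2.2) < e' /\
      `|m (F' x.2.1 x.2.2 y.2.1) - q y.1.2 (F' x.2.1 x.2.2 y.2.1)| < e'].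
  case: x => j [k F] /=; have [mF|] := pselect (measurable F); last first.
    by move=> nF; exists ((0, 0), (0, 0))%N.
  have [N HN] := near _ mF.
  have [n /[!geq_max]/andP[jn Nn] nBk] := large k (maxn j N).
  have [k1 kk1 nk1] := small n k.
  have mF' : measurable (F' k F k1) by apply/measurableU/measurableD.
  have [N' HN'] := near _ mF'.
  have [k2 kk2 nk2] := small (maxn j N') k1.
  exists ((n, maxn j N'), (k1, k2)) => _; split => //=.
  - by split => //; rewrite leq_maxl.
  - exact: HN.
  - by split => //; apply: HN'; rewrite leq_maxr.
have {step} [g Hg] := choice step.
have [st [n [n' [k1 [st0 mF G FS]]]]] :
    exists (st : nat -> nat * set T) (n n' k1 : nat -> nat), [/\
      (st 0%N).2 `&` B (st 0%N).1 = set0,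
      forall j, measurable (st j).2,
      forall j, [/\ (j <= n j)%N /\ (j <= n' j)%N,
        ((st j).1 <= k1 j)%N /\ (k1 j <= (st j.+1).1)%N,
        e < q (n j) (B (st j).1) /\ q (n j) (B (k1 j)) < e',
        `|m (st j).2 - q (n j) (st j).2| < e' &
        q (n' j) (B (st j.+1).1) < e' /\
        `|m (st j.+1).2 - q (n' j) (st j.+1).2| < e'] &
      forall j, (st j.+1).2 = (st j).2 `|` (B (st j).1 `\` B (k1 j))].
  pose st := fix st j : nat * set T := if j is i.+1 then
    ((g (i, st i)).2.2, F' (st i).1 (st i).2 (g (i, st i)).2.1)
  else (0%N, set0).
  have mF j : measurable (st j).2.
    elim: j => [|j IH] /=; first exact: measurable0.
    by apply: measurableU => //; exact: measurableD.
  exists st, (fun j => (g (j, st j)).1.1), (fun j => (g (j, st j)).1.2),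
    (fun j => (g (j, st j)).2.1); split => //; first by rewrite set0I.
  by move=> j; have := Hg (j, st j) (mF j).
have kS j : ((st j).1 <= (st j.+1).1)%N.
  by have [_ [h1 h2] _ _ _] := G j; exact: leq_trans h1 h2.
have kmono i j : (i <= j)%N -> ((st i).1 <= (st j).1)%N.
  apply: (@homo_leq _ (fun i => (st i).1) leq) => //.
  by move=> a b c; exact: leq_trans.
have Fmono i j : (i <= j)%N -> (st i).2 `<=` (st j).2.
  apply: (@homo_leq _ (fun i => (st i).2) (fun A B => A `<=` B)) => //.
  - by move=> A; exact: subset_refl.
  - by move=> A1 A2 A3 h1 h2; exact: subset_trans h1 h2.
  - by move=> ?; rewrite FS; exact: subsetUl.
have FB j : (st j).2 `&` B (st j).1 = set0.
  elim: j => [//|j IH].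
  have [_ [? ?] _ _ _] := G j; rewrite FS.
  apply/seteqP; split => // x [[Fx|[Bx Bnx]] B2x].
    have : ((st j).2 `&` B (st j).1) x by split => //; apply: Bmono B2x.
    by rewrite IH.
  by apply: Bnx; exact: Bmono B2x.
pose E := \bigcup_j (st j).2.
have mE : measurable E by exact: bigcupT_measurable.
have EF j : E `<=` (st j).2 `|` B (st j).1.
  move=> x [i _]; elim: i => [|i IH] Fx; first by left; exact: Fmono Fx.
  have [ij|ij] := leqP i.+1 j; first by left; exact: Fmono Fx.
  move: Fx; rewrite FS => -[/IH //|[Bx _]]; right.
  by apply: Bmono Bx; exact: kmono.
have m_mono A A' : measurable A -> measurable A' -> A `<=` A' -> m A <= m A'.
  move=> mA mA' AA'; apply: ler_cvg_to (mum _ mA) (mum _ mA') _.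
  by near=> i; exact: fine_le_measure.
have [N HN] := near _ mE.
(* Along the first subsequence [E] carries a hump of size about [e] on top of each [m F_i]. *)
have low i : m (st i).2 + 7 * e' <= m E.
  pose j := maxn i N.
  have Fij : m (st i).2 <= m (st j).2 by apply: m_mono => //; apply: Fmono; rewrite leq_maxl.
  have Ej : (st j.+1).2 `<=` E by move=> x Fx; exists j.+1.
  have [[jn _] [kk1 _] [big sm] mFn _] := G j.
  have Nn : (N <= n j)%N by rewrite (leq_trans _ jn)// leq_maxr.
  have mD : measurable (B (st j).1 `\` B (k1 j)) by exact: measurableD.
  have := fine_le_measure (mu1 (n j)) (mF j.+1) mE Ej.
  rewrite FS fine_measureU//; last first.
    by apply/seteqP; split => // x [Fx [Bx _]]; rewrite -(FB j); split.
  rewrite fine_measureD//; last exact: Bmono.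
  have := HN _ Nn; move: mFn big sm; rewrite -!/(q _ _) !ltr_norml.
  by move=> /andP[? ?] ? ? /andP[? ?] ?; lra.
(* Along the second subsequence [E] is contained in the next [F] up to a tail of mass below [e'], so
   [m E] exceeds [m] of that set by less than [3 * e'], against the [7 * e'] of [low]. *)
suff : e' <= 0 by rewrite leNgt e'0.
have [[_ Nn'] _ _ _ [sm]] := G N.
have mFB : measurable ((st N.+1).2 `|` B (st N.+1).1) by exact: measurableU.
have := fine_measureU_le (mu1 (n' N)) (mF N.+1) (mB (st N.+1).1).
have := fine_le_measure (mu1 (n' N)) mE mFB (EF N.+1).
have := low N.+1; have := HN _ Nn'; move: sm; rewrite -!/(q _ _) !ltr_norml.
move: (q _ E) (q _ (_ `|` _)) (q _ (st _).2) (q _ (B _)) (m E) (m (st _).2).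
by move=> ? ? ? ? ? ? ? /andP[? ?] ? ? ? /andP[? ?]; lra.
Unshelve. all: by end_near. Qed.

(** * Bessel's inequality *)

Lemma cvg0P (R : realType) (u : nat -> R) :
  u @ \oo --> (0 : R) <-> forall e : R, 0 < e -> \forall n \near \oo, `|u n| <= e.
Proof.
split=> [/cvgrPdist_le u0 e e0|u0].
  by have := u0 e e0; apply: filterS => n; rewrite sub0r normrN.
apply/cvgrPdist_le => e e0; have := u0 e e0.
by apply: filterS => n; rewrite sub0r normrN.
Qed.

Lemma cvg0_le (R : realType) (u v : nat -> R) :
  (forall n, `|u n| <= v n) -> v @ \oo --> (0 : R) -> u @ \oo --> (0 : R).
Proof.
move=> uv /cvg0P v0; apply/cvg0P => e /v0; apply: filterS => n.
by apply: le_trans; rewrite (le_trans (uv n))// ler_norm.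
Qed.

(** Lets exact identities be proved through [bmf_cvg0], applied to a sequence that does not depend
    on [n]. *)
Lemma cst_cvg0 (R : realType) (c : R) : (fun _ : nat => c) @ \oo --> (0 : R) -> c = 0.
Proof. by move=> c0; apply: (@cvg_unique _ (@Rhausdorff R) _ _ _ _ (cvg_cst c) c0). Qed.

(** Only bounds on [|L n f|] of the kind satisfied by a seminorm are assumed, so that [L n] may be a
    linear functional or an L1 norm. That [C] is independent of [n] makes the class of good [f]
    closed under uniform limits. *)
Lemma bmf_cvg0 d (T : measurableType d) (R : realType)
    (L : nat -> (T -> R) -> R) (C : R) :
  (forall n c f, bmf f -> `|L n (fun x => c * f x)| <= `|c| * `|L n f|) ->
  (forall n f g, bmf f -> bmf g ->
     `|L n (fun x => f x + g x)| <= `|L n f| + `|L n g|) ->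
  (forall n f (e : R), bmf f -> (forall x, `|f x| <= e) -> `|L n f| <= C * e) ->
  (forall A, measurable A -> L n \1_A @[n --> \oo] --> (0 : R)) ->
  forall f, bmf f -> L n f @[n --> \oo] --> (0 : R).
Proof.
move=> LZ LD LC L1; apply: bmf_ind => //.
- move=> c f bf /cvg_norm; rewrite normr0 => f0; 
  apply: (@cvg0_le _ _ (fun n => `|c| * `|L n f|)); first by move=> n; exact: LZ.
  by rewrite -[X in _ --> X](mulr0 `|c|); exact: cvgMr.
- move=> f g bf bg /cvg_norm + /cvg_norm; rewrite normr0 => f0 g0.
  apply: (@cvg0_le _ _ (fun n => `|L n f| + `|L n g|)); first by move=> n; exact: LD.
  by rewrite -[X in _ --> X](addr0 0); exact: cvgD.
- move=> f bf H; apply/cvg0P => e e0.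
  pose e' := e / 2 / (`|C| + 1).
  have C1 : 0 < `|C| + 1 by rewrite ltr_wpDl.
  have e'0 : 0 < e' by rewrite !divr_gt0.
  have [g [bg /cvg0P/(_ (e / 2)) g0 fg]] := H e' e'0.
  have := g0 (divr_gt0 e0 (ltr0Sn R 1)); apply: filterS => n Lg.
  have -> : f = (fun x => g x + (f x - g x)) by apply/funext => x; lra.
  rewrite (le_trans (LD _ _ _ _ _))//; first exact: bmfB.
  rewrite [leRHS]splitr lerD// (le_trans (LC n _ e' _ _))//; first exact: bmfB.
  have -> : e / 2 = (`|C| + 1) * e' by rewrite [RHS]mulrC divfK// gt_eqF.
  apply: ler_wpM2r; first exact: ltW.
  by apply: le_trans (ler_norm _) _; rewrite lerDl.
Qed.

Section mean_more.
Context d (T : measurableType d) (R : realType).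
Variables (mu : {measure set T -> \bar R}) (mu1 : mu setT = 1%E).
Implicit Types f g : T -> R.

Lemma norm_mean_bound f e : bmf f -> (forall x, `|f x| <= e) ->
  `|\int[mu]_x f x| <= e.
Proof.
move=> bf fe; rewrite (le_trans (norm_mean_le mu1 bf))//.
rewrite -[leRHS](mean_cst mu1) le_mean//; [exact: bmf_norm|exact: bmf_cst].
Qed.

Lemma mean_norm_le f e : bmf f -> (forall x, `|f x| <= e) ->
  \int[mu]_x `|f x| <= e.
Proof.
move=> bf fe.
rewrite -[leRHS](mean_cst mu1) le_mean//; [exact: bmf_norm|exact: bmf_cst].
Qed.

Lemma mean_norm_triangle f g : bmf f -> bmf g ->
  \int[mu]_x `|f x + g x| <= \int[mu]_x `|f x| + \int[mu]_x `|g x|.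
Proof.
move=> bf bg; have [nf ng] := (bmf_norm bf, bmf_norm bg).
rewrite -meanD// le_mean//; [exact/bmf_norm/bmfD|exact: bmfD|].
by move=> x; exact: ler_normD.
Qed.

End mean_more.

(* Bessel's inequality: the coefficients of [Z] along an orthogonal bounded
   sequence are square summable. *)
Lemma orthogonal_cvg0 d (T : measurableType d) (R : realType)
    (P : probability T R) (Y : nat -> T -> R) (C : R) (Z : T -> R) :
  (forall n, bmf (Y n)) -> (forall n x, `|Y n x| <= C) ->
  (forall m n, (m < n)%N -> \int[P]_x (Y m x * Y n x) = 0) -> bmf Z ->
  \int[P]_x (Z x * Y n x) @[n --> \oo] --> (0 : R).
Proof.
move=> bY YC Yorth bZ; have P1 := @probability_setT _ _ _ P.
have [a aE] : exists a : nat -> R, forall n, \int[P]_x (Z x * Y n x) = a n.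
  by exists (fun n => \int[P]_x (Z x * Y n x)).
rewrite (_ : (fun n => _) = a); last exact/funext.
(* A bound on the second moments of the [Y n], enlarged by 1 so that it is positive and can be
   cancelled at the end of [bessel]. *)
pose D := C ^+ 2 + 1; have D0 : 0 < D by rewrite ltr_wpDl// sqr_ge0.
have YD n : \int[P]_x (Y n x ^+ 2) <= D.
  rewrite (@le_trans _ _ (C ^+ 2)) ?lerDl// -[leRHS](mean_cst P1) le_mean//.
  - exact/bmf_sqr.
  - exact: bmf_cst.
  - by move=> x; rewrite -(real_normK (num_real (Y n x))) lerXn2r ?nnegrE// (le_trans _ (YC n x)).
pose s N := fun x => \sum_(n < N) a n * Y n x.
have baY n : bmf (fun x => a n * Y n x) by exact: bmfZ.
have bs N : bmf (s N) := bmf_sum N baY.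
have sS N : s N.+1 = fun x => s N x + a N * Y N x.
  by apply/funext => x; rewrite /s big_ord_recr.
have sY N m : (N <= m)%N -> \int[P]_x (s N x * Y m x) = 0.
  move=> Nm; elim: N Nm => [|N IH] Nm.
    under eq_Rintegral do rewrite /s big_ord0 mul0r.
    exact: mean_cst.
  rewrite sS; under eq_Rintegral do rewrite mulrDl -mulrA.
  rewrite meanD//; [|exact: bmfM|exact/bmfZ/bmfM].
  by rewrite IH 1?ltnW// meanZ ?Yorth ?mulr0 ?addr0//; exact: bmfM.
have ss N : \int[P]_x (s N x ^+ 2) <= D * \sum_(n < N) a n ^+ 2.
  elim: N => [|N IH].
    under eq_Rintegral do rewrite /s big_ord0 expr0n /=.
    by rewrite big_ord0 mulr0 mean_cst.
  rewrite big_ord_recr /= mulrDr.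
  have -> : \int[P]_x (s N.+1 x ^+ 2) = \int[P]_x (s N x ^+ 2) +
      (2 * a N * \int[P]_x (s N x * Y N x) + a N ^+ 2 * \int[P]_x (Y N x ^+ 2)).
    rewrite -!meanZ -?meanD//; try bmf_tac.
    by apply: eq_Rintegral => x _; rewrite sS /=; ring.
  rewrite sY// mulr0 add0r lerD// mulrC ler_wpM2r ?sqr_ge0//.
have Zs N : \int[P]_x (Z x * s N x) = \sum_(n < N) a n ^+ 2.
  elim: N => [|N IH].
    under eq_Rintegral do rewrite /s big_ord0 mulr0.
    by rewrite big_ord0 mean_cst.
  rewrite big_ord_recr /= -IH sS.
  under eq_Rintegral do rewrite mulrDr mulrCA.
  rewrite meanD//; [|exact: bmfM|exact/bmfZ/bmfM].
  by rewrite meanZ ?aE -?expr2//; exact: bmfM.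
(* The [Y n] are not normalised, so [s N] is compared with [D * Z] instead of [Z]: with [A] the sum
   of squares, 0 <= E (s - D Z)^2 <= D A - 2 D A + D^2 E Z^2. *)
have bessel N : \sum_(n < N) a n ^+ 2 <= D * \int[P]_x (Z x ^+ 2).
  set A := \sum_(n < N) _.
  have : 0 <= \int[P]_x ((s N x - D * Z x) ^+ 2).
    by apply: mean_ge0 => x; exact: sqr_ge0.
  have -> : \int[P]_x ((s N x - D * Z x) ^+ 2) = \int[P]_x (s N x ^+ 2) +
      ((- 2 * D) * \int[P]_x (Z x * s N x) + D ^+ 2 * \int[P]_x (Z x ^+ 2)).
    rewrite -!meanZ -?meanD//; try bmf_tac.
    by apply: eq_Rintegral => x _; ring.
  rewrite Zs -/A => H; have := ss N; rewrite -/A => H2.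
  rewrite -(ler_pM2l D0); move: H H2; move: (Rintegral _ _ _) (Rintegral _ _ _) => u v.
  by move=> ? ?; nra.
have cv : cvgn (series (fun n => a n ^+ 2)).
  apply: nondecreasing_is_cvgn.
    by apply/nondecreasing_seqP => n; rewrite /series/= big_nat_recr//= lerDl sqr_ge0.
  exists (D * \int[P]_x (Z x ^+ 2)) => _ [N _ <-]; rewrite /series/= big_mkord.
  exact: bessel.
have /cvg0P a2 := cvg_series_cvg_0 cv.
apply/cvg0P => e e0; have := a2 _ (exprn_gt0 2 e0); apply: filterS => n.
by rewrite normrX ler_pXn2r ?nnegrE// ltW.
Qed.

(** * Kernel means and predictive distributions *)

Lemma cvg0_eq (R : realType) (u v : nat -> R) (l : R) :
  (u n - v n) @[n --> \oo] --> (0 : R) -> v @ \oo --> l -> u @ \oo --> l.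
Proof.
move=> uv vl; rewrite -[l]add0r (_ : u = fun n => (u n - v n) + v n).
  exact: cvgD.
by apply/funext => n; rewrite subrK.
Qed.

Section kernel_mean.
Context d d' (Omega : measurableType d) (T : measurableType d') (R : realType).
Implicit Types (alpha : R.-pker Omega ~> T) (f g : T -> R).

Lemma kernel_mean_indic alpha B w : measurable B ->
  kernel_mean alpha \1_B w = fine (alpha w B).
Proof. by move=> mB; rewrite /kernel_mean mean_indic. Qed.

Lemma kernel_meanD alpha f g w : bmf f -> bmf g ->
  kernel_mean alpha (fun x => f x + g x) w = kernel_mean alpha f w + kernel_mean alpha g w.
Proof. by move=> bf bg; rewrite /kernel_mean meanD// prob_kernel. Qed.

Lemma kernel_meanB alpha f g w : bmf f -> bmf g ->
  kernel_mean alpha (fun x => f x - g x) w = kernel_mean alpha f w - kernel_mean alpha g w.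
Proof. by move=> bf bg; rewrite /kernel_mean meanB// prob_kernel. Qed.

Lemma kernel_meanZ alpha c f w : bmf f ->
  kernel_mean alpha (fun x => c * f x) w = c * kernel_mean alpha f w.
Proof. by move=> bf; rewrite /kernel_mean meanZ// prob_kernel. Qed.

Lemma kernel_mean_bound alpha f e w : bmf f -> (forall x, `|f x| <= e) ->
  `|kernel_mean alpha f w| <= e.
Proof. by move=> bf fe; apply: norm_mean_bound; rewrite ?prob_kernel. Qed.

(* [T0] is [Omega] with a possibly coarser sigma-algebra. *)
Lemma measurable_kernel_mean d0 (T0 : measurableType d0) (h : T0 -> Omega) alpha f :
  (forall B, measurable B -> measurable_fun setT (fun w => fine (alpha (h w) B))) ->
  bmf f -> measurable_fun setT (fun w => kernel_mean alpha f (h w)).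
Proof.
move=> mh; move: f; apply: bmf_ind.
- move=> B mB; under eq_fun do rewrite kernel_mean_indic//.
  exact: mh.
- move=> c f bf mf; under eq_fun do rewrite kernel_meanZ//.
  by apply: measurable_funM => //; exact: measurable_cst.
- move=> f g bf bg mf mg; under eq_fun do rewrite kernel_meanD//.
  exact: measurable_funD.
- move=> f bf H.
  have /choice[g Hg] n : exists g, [/\ bmf g,
      measurable_fun setT (fun w => kernel_mean alpha g (h w)) &
      forall x, `|f x - g x| <= n.+1%:R^-1].
    by apply: H; rewrite invr_gt0.
  apply: (@measurable_fun_cvg _ _ _ _ (fun n w => kernel_mean alpha (g n) (h w))).
    by move=> n; have [] := Hg n.
  move=> w _; apply/cvgrPdist_le => e e0.
  near=> n; have [bg _ fg] := Hg n.
  rewrite -kernel_meanB//; apply: kernel_mean_bound; first exact: bmfB.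
  move=> x; rewrite (le_trans (fg x))//; near: n.
  have /cvgrPdist_le/(_ e e0) := @cvg_harmonic R.
  by apply: filterS => n; rewrite sub0r normrN ger0_norm// invr_ge0.
Unshelve. all: by end_near. Qed.

Lemma measurable_fine_kernel alpha B : measurable B ->
  measurable_fun setT (fun w => fine (alpha w B)).
Proof.
by move=> mB; apply: measurableT_comp => //; exact: measurable_kernel.
Qed.

Lemma bmf_kernel_mean alpha f : bmf f -> bmf (kernel_mean alpha f).
Proof.
move=> bf; split.
  by apply: (@measurable_kernel_mean _ _ id) => // B mB; exact: measurable_fine_kernel.
by have [_ [K fK]] := bf; exists K => w; exact: kernel_mean_bound.
Qed.

End kernel_mean.

Section predictive.
Context d d' (Omega : measurableType d) (T : measurableType d') (R : realType).
Variables (P : probability Omega R) (X : nat -> {RV P >-> T}).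
Variables (alpha_ : nat -> R.-pker Omega ~> T).
Hypothesis halpha : predictive_distributions X alpha_.
Implicit Types f g : T -> R.

Let P1 : P setT = 1%E := probability_setT P.

Let F n := natural_filtration X n.
Let OF n : measurableType _ := g_sigma_algebraType (F n).

(** [OF n] carries the sigma-algebra generated by [F n], which is itself a generated one; the second
    generation adds nothing. *)
Lemma natural_filtration_generated n A :
  measurable (A : set (OF n)) -> natural_filtration X n A.
Proof. by rewrite /measurable /= /F /natural_filtration (smallest_id (@smallest_sigma_algebra _ _ _)). Qed.

Lemma natural_filtrationS m n : (m <= n)%N ->
  natural_filtration X m `<=` natural_filtration X n.
Proof.
move=> mn; apply: sub_sigma_algebra2 => A [i /= im HA]; exists i => //=.
exact: leq_trans im mn.
Qed.

Lemma natural_filtration_sub n A : natural_filtration X n A -> measurable A.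
Proof.
move: A; apply: (@smallest_sub _ (sigma_algebra setT) _ (@measurable _ Omega)).
  exact: sigma_algebra_measurable.
move=> A [i /= _ [B mB <-]].
by rewrite setTI -[X in measurable X]setTI; exact: measurable_funPT.
Qed.

Lemma bmf_filtration n (Z : OF n -> R) : bmf Z -> bmf (Z : Omega -> R).
Proof.
move=> [mZ bZ]; split => // _ B mB.
apply: (@natural_filtration_sub n); apply: natural_filtration_generated.
exact: mZ.
Qed.

Lemma bmf_filtration_X m n f : (m < n)%N -> bmf f -> bmf ((f \o X m) : OF n -> R).
Proof.
move=> mn bf; apply: (bmf_comp (h := X m : OF n -> T)) bf _ => _ B mB.
apply: sub_sigma_algebra; apply: sub_sigma_algebra; exists m => //=.
by exists B.
Qed.

Lemma bmf_filtration_kernel m n f : (m <= n)%N -> bmf f ->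
  bmf ((kernel_mean (alpha_ m) f) : OF n -> R).
Proof.
move=> mn bf; split; last by have [] := bmf_kernel_mean (alpha_ m) bf.
apply: (@measurable_kernel_mean _ _ Omega T R _ (OF n) (fun w => w) (alpha_ m) f _ bf).
move=> B mB _ C mC.
have [_ mZ _] := halpha m mB.
apply: sub_sigma_algebra; apply: (natural_filtrationS mn).
by apply: natural_filtration_generated; exact: mZ.
Qed.

Lemma bmf_X n f : bmf f -> bmf (f \o X n).
Proof. by move=> bf; apply: bmf_comp. Qed.

Lemma mean_restrict A (Y : Omega -> R) :
  \int[P]_(w in A) Y w = \int[P]_w (\1_A w * Y w).
Proof.
rewrite Rintegral_mkcond; apply: eq_Rintegral => w _.
by rewrite patchE indicE; case: (w \in A); rewrite ?mul1r ?mul0r.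
Qed.

(** For indicator [f] this is the defining property of the predictive distribution. The difference
    [L] of the two sides is linear and bounded by 2 times the sup norm of [f], so it vanishes for
    all bounded measurable [f]. [predictive_mean] repeats the argument in the other factor. *)
Lemma predictive_mean_indic n f A : F n A -> bmf f ->
  \int[P]_w (\1_A w * f (X n w)) = \int[P]_w (\1_A w * kernel_mean (alpha_ n) f w).
Proof.
move=> FA bf; have mA := natural_filtration_sub FA.
have b1 : bmf (\1_A : Omega -> R) by exact: bmf_indic.
have bX g (bg : bmf g) : bmf (fun w => g (X n w)) := bmf_X n bg.
have bK g (bg : bmf g) := bmf_kernel_mean (alpha_ n) bg.
apply/eqP; rewrite -subr_eq0; apply/eqP.
pose L g := \int[P]_w (\1_A w * g (X n w)) -
  \int[P]_w (\1_A w * kernel_mean (alpha_ n) g w).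
have LE g : bmf g -> L g = \int[P]_w (\1_A w * (g (X n w) - kernel_mean (alpha_ n) g w)).
  move=> bg; rewrite /L -meanB//; [|exact/bmfM/bX|exact/bmfM/bK].
  by apply: eq_Rintegral => w _; rewrite mulrBr.
apply: (@cst_cvg0 R); apply: (@bmf_cvg0 _ T R (fun _ => L) 2) bf.
- move=> _ c g bg; rewrite -normrM !LE//; last exact: bmfZ.
  rewrite -meanZ//; last by apply: bmfM => //; apply: bmfB; [exact: bX|exact: bK].
  suff -> : \int[P]_w (\1_A w * (c * g (X n w) - kernel_mean (alpha_ n) (fun x => c * g x) w))
    = \int[P]_w (c * (\1_A w * (g (X n w) - kernel_mean (alpha_ n) g w))) by [].
  by apply: eq_Rintegral => w _; rewrite kernel_meanZ//; ring.
- move=> _ g h bg bh; rewrite !LE//; last exact: bmfD.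
  apply: le_trans (ler_normD _ _); rewrite -meanD//; last 2 first.
    by apply: bmfM => //; apply: bmfB; [exact: bX|exact: bK].
    by apply: bmfM => //; apply: bmfB; [exact: bX|exact: bK].
  suff -> : \int[P]_w (\1_A w * ((g (X n w) + h (X n w)) -
       kernel_mean (alpha_ n) (fun x => g x + h x) w)) =
     \int[P]_w (\1_A w * (g (X n w) - kernel_mean (alpha_ n) g w) +
       \1_A w * (h (X n w) - kernel_mean (alpha_ n) h w)) by [].
  by apply: eq_Rintegral => w _; rewrite kernel_meanD//; ring.
- move=> _ g e bg ge; rewrite LE//; apply: norm_mean_bound => //.
    by apply: bmfM => //; apply: bmfB; [exact: bX|exact: bK].
  move=> w; rewrite normrM indicE.
  apply: (@le_trans _ _ (1 * `|g (X n w) - kernel_mean (alpha_ n) g w|)).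
    by rewrite ler_wpM2r//; case: (_ \in _); rewrite /= ?normr1 ?normr0.
  rewrite mul1r (le_trans (ler_normB _ _))// mulr_natl mulr2n lerD//.
  exact: kernel_mean_bound.
- move=> B mB; rewrite (_ : L _ = 0); first exact: cvg_cst.
  have [_ _ /(_ A FA) E] := halpha n mB.
  apply/eqP; rewrite subr_eq0 -!mean_restrict; apply/eqP/esym.
  rewrite /Rintegral; congr fine.
  by under eq_integral do rewrite kernel_mean_indic//.
Qed.

Lemma predictive_mean n f (Z : OF n -> R) : bmf f -> bmf Z ->
  \int[P]_w (Z w * f (X n w)) = \int[P]_w (Z w * kernel_mean (alpha_ n) f w).
Proof.
move=> bf bZ.
have bX : bmf (fun w => f (X n w)) := bmf_X n bf.
have bK := bmf_kernel_mean (alpha_ n) bf.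
apply/eqP; rewrite -subr_eq0; apply/eqP.
have [_ [K fK]] := bf.
pose D w := f (X n w) - kernel_mean (alpha_ n) f w.
have bD : bmf D by exact: bmfB.
pose L (Y : OF n -> R) := \int[P]_w (Y w * f (X n w)) -
  \int[P]_w (Y w * kernel_mean (alpha_ n) f w).
have LE (Y : OF n -> R) : bmf Y -> L Y = \int[P]_w (Y w * D w).
  move=> /bmf_filtration bY; rewrite /L -meanB//; [|exact: bmfM|exact: bmfM].
  by apply: eq_Rintegral => w _; rewrite mulrBr.
apply: (@cst_cvg0 R); apply: (@bmf_cvg0 _ (OF n) R (fun _ => L) (2 * K)) bZ.
- move=> _ c Y bY; rewrite -normrM !LE//; last exact: bmfZ.
  have bY' := bmf_filtration bY.
  rewrite -meanZ//; last exact: bmfM.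
  by under eq_Rintegral do rewrite -mulrA.
- move=> _ Y1 Y2 bY1 bY2; rewrite !LE//; last exact: bmfD.
  have [bY1' bY2'] := (bmf_filtration bY1, bmf_filtration bY2).
  apply: le_trans (ler_normD _ _); rewrite -meanD//; [|exact: bmfM|exact: bmfM].
  by under eq_Rintegral do rewrite mulrDl.
- move=> _ Y e bY Ye; have bY' := bmf_filtration bY.
  rewrite LE//; apply: norm_mean_bound => //; first exact: bmfM.
  move=> w; rewrite normrM mulrC ler_pM//.
  rewrite (le_trans (ler_normB _ _))// mulr_natl mulr2n lerD//.
  exact: kernel_mean_bound.
- move=> A /natural_filtration_generated FA.
  rewrite (_ : L _ = 0); first exact: cvg_cst.
  by apply/eqP; rewrite subr_eq0; apply/eqP; exact: predictive_mean_indic.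
Qed.

Lemma predictive_mean1 n f : bmf f ->
  \int[P]_w f (X n w) = \int[P]_w kernel_mean (alpha_ n) f w.
Proof.
move=> bf; have := @predictive_mean n f (fun _ => 1) bf (bmf_cst _ 1).
by under eq_Rintegral do rewrite mul1r; under [RHS]eq_Rintegral do rewrite mul1r.
Qed.

(* The innovations [f (X n) - alpha_ n f] are bounded martingale differences,
   hence orthogonal. *)
Lemma innovation_cvg0 f (Z : Omega -> R) : bmf f -> bmf Z ->
  \int[P]_w (Z w * (f (X n w) - kernel_mean (alpha_ n) f w)) @[n --> \oo]
    --> (0 : R).
Proof.
move=> bf bZ; have [_ [K fK]] := bf.
have bX n : bmf (fun w => f (X n w)) := bmf_X n bf.
have bK n := bmf_kernel_mean (alpha_ n) bf.
apply: (@orthogonal_cvg0 _ _ _ _ _ (2 * K)) => //.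
- by move=> n; exact: bmfB.
- move=> n w; rewrite (le_trans (ler_normB _ _))// mulr_natl mulr2n lerD//.
  exact: kernel_mean_bound.
- move=> m n mn.
  pose Z' : OF n -> R := fun w => f (X m w) - kernel_mean (alpha_ m) f w.
  have bZ' : bmf Z'.
    by apply: bmfB; [exact: bmf_filtration_X|exact/bmf_filtration_kernel/bf/ltnW].
  have := predictive_mean bf bZ'; rewrite /Z' => H.
  under eq_Rintegral do rewrite mulrBr.
  rewrite meanB ?H ?subrr//; try by apply: bmfM => //; exact: bmfB.
Qed.

Lemma stable_predictive f (Z : Omega -> R) (l : R) : bmf f -> bmf Z ->
  (\int[P]_w (Z w * f (X n w)) @[n --> \oo] --> l) <->
  (\int[P]_w (Z w * kernel_mean (alpha_ n) f w) @[n --> \oo] --> l).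
Proof.
move=> bf bZ.
have bX n : bmf (fun w => f (X n w)) := bmf_X n bf.
have bK n := bmf_kernel_mean (alpha_ n) bf.
have := innovation_cvg0 bf bZ.
rewrite (_ : (fun n => _) = (fun n => \int[P]_w (Z w * f (X n w)) -
    \int[P]_w (Z w * kernel_mean (alpha_ n) f w))); last first.
  apply/funext => n; rewrite -meanB//; [|exact: bmfM|exact: bmfM].
  by apply: eq_Rintegral => w _; rewrite mulrBr.
move=> I; split; apply: cvg0_eq => //.
apply/cvg0P => e e0; move/cvg0P : I => /(_ e e0).
by apply: filterS => n; rewrite distrC.
Qed.

End predictive.

(** * Convergence in L1 *)

Section l1_convergence.
Context d (T : measurableType d) (R : realType) (P : probability T R).
Implicit Types (K : nat -> T -> R) (V Z : T -> R).

Let P1 : P setT = 1%E := probability_setT P.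

Lemma l1_cvg_mean K V Z : (forall n, bmf (K n)) -> bmf V -> bmf Z ->
  \int[P]_w `|K n w - V w| @[n --> \oo] --> (0 : R) ->
  \int[P]_w (Z w * K n w) @[n --> \oo] --> \int[P]_w (Z w * V w).
Proof.
move=> bK bV bZ KV; have [_ [C ZC]] := bZ.
apply: (@cvg0_eq _ _ (fun _ => \int[P]_w (Z w * V w))); last exact: cvg_cst.
apply: (@cvg0_le _ _ (fun n => C * \int[P]_w `|K n w - V w|)); last first.
  by rewrite -[X in _ --> X](mulr0 C); exact: cvgMr.
move=> n; rewrite -meanB//; [|bmf_tac..].
rewrite -meanZ//; last bmf_tac.
apply: (le_trans (norm_mean_le P1 _)); first bmf_tac.
apply: le_mean => //; [bmf_tac..|].
by move=> w; rewrite -mulrBr normrM ler_wpM2r.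
Qed.

Lemma l1_cvg_mean1 K V : (forall n, bmf (K n)) -> bmf V ->
  \int[P]_w `|K n w - V w| @[n --> \oo] --> (0 : R) ->
  \int[P]_w K n w @[n --> \oo] --> \int[P]_w V w.
Proof.
move=> bK bV KV; have := l1_cvg_mean bK bV (bmf_cst T 1) KV.
under eq_fun do (under eq_Rintegral do rewrite mul1r).
rewrite (_ : \int[P]_w (1 * V w) = \int[P]_w V w)//.
by apply: eq_Rintegral => w _; rewrite mul1r.
Qed.

Lemma l1_cvg_sqr K V C : (forall n, bmf (K n)) -> bmf V ->
  (forall n w, `|K n w| <= C) -> (forall w, `|V w| <= C) ->
  \int[P]_w `|K n w - V w| @[n --> \oo] --> (0 : R) ->
  \int[P]_w (K n w ^+ 2) @[n --> \oo] --> \int[P]_w (V w ^+ 2).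
Proof.
move=> bK bV KC VC KV.
apply: (@cvg0_eq _ _ (fun _ => \int[P]_w (V w ^+ 2))); last exact: cvg_cst.
apply: (@cvg0_le _ _ (fun n => (C + C) * \int[P]_w `|K n w - V w|)); last first.
  by rewrite -[X in _ --> X](mulr0 (C + C)); exact: cvgMr.
move=> n; rewrite -meanB//; [|bmf_tac..].
rewrite -meanZ//; last bmf_tac.
apply: (le_trans (norm_mean_le P1 _)); first bmf_tac.
apply: le_mean => //; [bmf_tac..|].
move=> w; rewrite subr_sqr normrM mulrC ler_wpM2r//.
by rewrite (le_trans (ler_normD _ _))// lerD.
Qed.

Lemma markov_mean V e : bmf V -> 0 < e ->
  fine (P [set w | e < `|V w|]) <= e^-1 * \int[P]_w `|V w|.
Proof.
move=> bV e0; have bNV := bmf_norm bV.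
have mA : measurable [set w | e < `|V w|].
  have -> : [set w | e < `|V w|] = setT `&` (fun w => `|V w|) @^-1` `]e, +oo[.
    by rewrite setTI; apply/seteqP; split => w /=; rewrite in_itv/= andbT.
  by have [mV _] := bNV; exact: mV.
rewrite -meanZ// -mean_indic//; apply: le_mean => //; [bmf_tac..|].
move=> w; rewrite indicE; case: (boolP (w \in _)) => /=.
  by rewrite inE /= => ew; rewrite mulrC ler_pdivlMr// mul1r ltW.
by rewrite mulr_ge0// invr_ge0 ltW.
Qed.

Lemma l1_cvg_probability K (V : {RV P >-> R}) : (forall n, bmf (K n)) -> bmf V ->
  \int[P]_w `|K n w - V w| @[n --> \oo] --> (0 : R) ->
  cvg_in_probability K V.
Proof.
move=> bK bV KV e e0.
have bKV n : bmf (fun w => K n w - V w) by bmf_tac.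
have mA n : measurable [set w | e < `|K n w - V w|].
  have -> : [set w | e < `|K n w - V w|] =
      setT `&` (fun w => `|K n w - V w|) @^-1` `]e, +oo[.
    by rewrite setTI; apply/seteqP; split => w /=; rewrite in_itv/= andbT.
  by have [mV _] := bmf_norm (bKV n); exact: mV.
rewrite (_ : (fun n => _) =
    fun n => (fine (P [set w | e < `|K n w - V w|]))%:E); last first.
  by apply/funext => n; rewrite fineK// prob_fin_num.
apply: cvg_EFin; first exact: nearW.
apply: (@cvg0_le _ _ (fun n => e^-1 * \int[P]_w `|K n w - V w|)); last first.
  by rewrite -[X in _ --> X](mulr0 e^-1); exact: cvgMr.
move=> n /=; rewrite ger0_norm; last exact: fine_ge0.
exact: markov_mean.
Qed.

(** With D = K - V, E D^2 = (E K^2 - E V^2) - 2 E (V D): the bracket tends to 0 by convergence of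
    the norms, the last term by weak convergence tested against [V] itself. *)
Lemma weak_l2_cvg_l1 K V C : (forall n, bmf (K n)) -> bmf V ->
  (forall n w, `|K n w| <= C) -> (forall w, `|V w| <= C) ->
  (forall H, measurable H ->
    \int[P]_w (\1_H w * K n w) @[n --> \oo] --> \int[P]_w (\1_H w * V w)) ->
  \int[P]_w (K n w ^+ 2) @[n --> \oo] --> \int[P]_w (V w ^+ 2) ->
  \int[P]_w `|K n w - V w| @[n --> \oo] --> (0 : R).
Proof.
move=> bK bV KC VC weak norms.
pose D n w := K n w - V w.
have bD n : bmf (D n) by apply: bmfB.
(* Weak convergence is assumed against indicators; testing against [V] requires bounded measurable
   [Z]. *)
have KVZ (Z : T -> R) : bmf Z -> \int[P]_w (Z w * D n w) @[n --> \oo] --> (0 : R).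
  move: Z; apply: (@bmf_cvg0 _ _ _ (fun n Z => \int[P]_w (Z w * D n w)) (C + C)).
  - move=> n c Z bZ; rewrite -normrM -meanZ//; last exact: bmfM.
    by under eq_Rintegral do rewrite -mulrA.
  - move=> n Z Z' bZ bZ'; apply: le_trans (ler_normD _ _).
    rewrite -meanD//; [|exact: bmfM..].
    by under eq_Rintegral do rewrite mulrDl.
  - move=> n Z e bZ Ze; apply: norm_mean_bound => //; first exact: bmfM.
    move=> w; rewrite normrM mulrC ler_pM// (le_trans (ler_normB _ _))//.
    by rewrite lerD.
  - move=> H mH; have bH : bmf (\1_H : T -> R) by exact: bmf_indic.
    rewrite (_ : (fun n => _) = (fun n => \int[P]_w (\1_H w * K n w) -
        \int[P]_w (\1_H w * V w))); last first.
      apply/funext => n; rewrite -meanB//; [|exact: bmfM..].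
      by apply: eq_Rintegral => w _; rewrite mulrBr.
    rewrite -[X in _ --> X](subrr (\int[P]_w (\1_H w * V w))).
    by apply: cvgB; [exact: weak|exact: cvg_cst].
have D2 : \int[P]_w (D n w ^+ 2) @[n --> \oo] --> (0 : R).
  have -> : (fun n => \int[P]_w (D n w ^+ 2)) = (fun n =>
      (\int[P]_w (K n w ^+ 2) - \int[P]_w (V w ^+ 2)) +
      (- 2) * \int[P]_w (V w * D n w)).
    apply/funext => n; rewrite -meanB -?meanZ -?meanD//; try bmf_tac.
    by apply: eq_Rintegral => w _; rewrite /D; ring.
  rewrite -[X in _ --> X](addr0 0); apply: cvgD.
    rewrite -[X in _ --> X](subrr (\int[P]_w (V w ^+ 2))).
    by apply: cvgB => //; exact: cvg_cst.
  rewrite -[X in _ --> X](mulr0 (- 2)); apply: cvgMr; exact: KVZ.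
apply/cvg0P => e e0.
pose e2 := e / 2; have e20 : 0 < e2 by rewrite divr_gt0.
have /cvg0P/(_ _ (mulr_gt0 e20 e20)) := D2; apply: filterS => n Dn.
rewrite ger0_norm ?mean_ge0//.
(* The pointwise bound |D| <= e2 + D^2 / e2 does the work of the Cauchy-Schwarz inequality. *)
apply: (@le_trans _ _ (\int[P]_w (e2 + e2^-1 * (D n w ^+ 2)))).
  apply: le_mean => //.
  - exact/bmf_norm/bD.
  - by apply: bmfD; [exact: bmf_cst|exact/bmfZ/bmf_sqr].
  move=> w; rewrite -/(D n w) -(real_normK (num_real (D n w))).
  rewrite -(ler_pM2l e20) mulrDr (mulrA e2 e2^-1) divff ?gt_eqF// mul1r.
  by have := sqr_ge0 (`|D n w| - e2); nra.
rewrite meanD//; [|exact: bmf_cst|exact/bmfZ/bmf_sqr].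
rewrite mean_cst// meanZ//; last exact/bmf_sqr.
rewrite [leRHS]splitr -/e2 lerD2l -(ler_pM2l e20) (mulrA e2 e2^-1) divff ?gt_eqF// mul1r.
exact: le_trans (ler_norm _) Dn.
Qed.

End l1_convergence.

Lemma kernel_l1_cvg d d' (Omega : measurableType d) (T : measurableType d')
    (R : realType) (P : probability Omega R)
    (alpha_ : nat -> R.-pker Omega ~> T) (alpha : R.-pker Omega ~> T) :
  (forall B, measurable B -> \int[P]_w
    `|kernel_mean (alpha_ n) \1_B w - kernel_mean alpha \1_B w| @[n --> \oo]
      --> (0 : R)) ->
  forall f, bmf f -> \int[P]_w
    `|kernel_mean (alpha_ n) f w - kernel_mean alpha f w| @[n --> \oo]
      --> (0 : R).
Proof.
have P1 : P setT = 1%E := probability_setT P.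
have bK k f : bmf f -> bmf (kernel_mean (alpha_ k) f) := @bmf_kernel_mean _ _ _ _ _ _ _.
have bV f : bmf f -> bmf (kernel_mean alpha f) := @bmf_kernel_mean _ _ _ _ _ _ _.
have bD k f : bmf f -> bmf (fun w => kernel_mean (alpha_ k) f w - kernel_mean alpha f w).
  by move=> bf; apply: bmfB; [exact: bK|exact: bV].
apply: (@bmf_cvg0 _ T R (fun n f => \int[P]_w
    `|kernel_mean (alpha_ n) f w - kernel_mean alpha f w|) 2).
- move=> n c f bf; rewrite -normrM.
  suff -> : \int[P]_w `|kernel_mean (alpha_ n) (fun x => c * f x) w -
      kernel_mean alpha (fun x => c * f x) w| =
      `|c| * \int[P]_w `|kernel_mean (alpha_ n) f w - kernel_mean alpha f w|.
    by rewrite !normrM normr_id.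
  rewrite -meanZ//; last exact/bmf_norm/bD.
  by apply: eq_Rintegral => w _; rewrite !kernel_meanZ// -mulrBr normrM.
- move=> n f g bf bg; rewrite !ger0_norm ?mean_ge0//.
  apply: le_trans (mean_norm_triangle P1 (bD n f bf) (bD n g bg)).
  apply: le_mean => //.
  + exact/bmf_norm/bD/bmfD.
  + by apply/bmf_norm/bmfD; exact: bD.
  + by move=> w; rewrite !kernel_meanD// opprD addrACA.
- move=> n f e bf fe; rewrite ger0_norm ?mean_ge0//.
  apply: mean_norm_le => //; first exact: bD.
  move=> w; rewrite (le_trans (ler_normB _ _))// mulr_natl mulr2n lerD//;
    exact: kernel_mean_bound.
Qed.

(** * Approximation of Borel sets by continuous functions *)

Lemma mean_bounded_cvg d (T : measurableType d) (R : realType)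
    (P : probability T R) (W : nat -> T -> R) (V : T -> R) (C : R) :
  (forall n, bmf (W n)) -> bmf V -> (forall n w, `|W n w| <= C) ->
  (forall w, W n w @[n --> \oo] --> V w) ->
  \int[P]_w W n w @[n --> \oo] --> \int[P]_w V w.
Proof.
move=> bW bV WC WV; have P1 : P setT = 1%E := probability_setT P.
suff /fine_cvgP[_] : (\int[P]_w (W n w)%:E)%E @[n --> \oo] --> (\int[P]_w V w)%:E by [].
rewrite mean_EFin//.
have := @dominated_convergence _ T R P setT measurableT
  (fun n w => (W n w)%:E) (fun w => (V w)%:E) (fun _ => C%:E).
case=> //.
- by move=> n; apply/measurable_EFinP; have [] := bW n.
- by apply/measurable_EFinP; have [] := bV.
- by apply: aeW => w _; apply: cvg_EFin; [exact: nearW|exact: WV].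
- by apply: (bmf_integrable P1); exact: bmf_cst.
- by apply: aeW => w n _; rewrite /= lee_fin.
Qed.

Lemma continuous_borel_measurable (R : realType) (S : ptopologicalType)
  (f : S -> R) : continuous f -> measurable_fun [set: borel S] (f : borel S -> R).
Proof.
move=> cf; apply: (measurability _ (RGenOInfty.measurableE R)) => //.
move=> _ [_ [a ->] <-]; rewrite setTI; apply: sub_sigma_algebra.
by move/continuousP : cf; apply; exact: interval_open.
Qed.

Lemma bmf_continuous (R : realType) (S : ptopologicalType) (f : S -> R) (K : R) :
  continuous f -> (forall x, `|f x| <= K) -> bmf (f : borel S -> R).
Proof. by move=> cf fK; split; [exact: continuous_borel_measurable|exists K]. Qed.

Definition indic_dist (R : realType) (S : Type) (B : set S) (g : S -> R) x :=
  `|\1_B x - g x|.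

(* The Borel sets that can be approximated by continuous functions form a
   sigma-algebra containing the cozero sets. *)
Section borel_approx.
Variables (R : realType) (S : ptopologicalType).
(** In the application [J n] integrates against the law of [X n] plus the mean law of [alpha], and
    [J_cont] combines Nikodym's theorem with dominated convergence. One index [k] serves all large
    [n] there, and hence so does one approximating function. *)
Variable J : nat -> (borel S -> R) -> R.
Hypothesis J_le : forall n f g, bmf f -> bmf g -> (forall x, f x <= g x) -> J n f <= J n g.
Hypothesis J_add : forall n f g, bmf f -> bmf g -> J n (fun x => f x + g x) <= J n f + J n g.
Hypothesis J_cont : forall B : nat -> set (borel S), (forall k, measurable (B k)) ->
  (forall k, B k.+1 `<=` B k) -> \bigcap_k B k = set0 ->
  forall e : R, 0 < e -> exists k, \forall n \near \oo, J n \1_(B k) <= e.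
Hypothesis cozero : forall U : set S, open U ->
  exists h : S -> R, [/\ continuous h, forall x, 0 <= h x & U = [set x | 0 < h x]].

Let approx (B : set (borel S)) := forall e : R, 0 < e ->
  exists g : S -> R, [/\ continuous g, forall x, 0 <= g x <= 1 &
    \forall n \near \oo, J n (indic_dist B g) <= e].

Let bmf_approx (g : S -> R) : continuous g -> (forall x, 0 <= g x <= 1) ->
  bmf (g : borel S -> R).
Proof.
move=> cg g01; apply: (@bmf_continuous _ _ _ 1) => // x.
by have /andP[g0 g1] := g01 x; rewrite ger0_norm.
Qed.

Let bmf_dist (B : set (borel S)) (g : S -> R) : measurable B ->
  bmf (g : borel S -> R) -> bmf (indic_dist B g : borel S -> R).
Proof. by move=> mB bg; apply/bmf_norm/bmfB => //; exact: bmf_indic. Qed.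

Let approx0 : approx set0.
Proof.
move=> e e0; exists (fun _ => 0); split => [x|x|].
- exact: cvg_cst.
- by rewrite lexx ler01.
(* [J_cont] along a constant sequence of empty sets bounds [J n] of the zero function. *)
- pose B (k : nat) : set (borel S) := set0.
  have B0 : \bigcap_k B k = set0 by apply/seteqP; split => // x /(_ 0%N I).
  have [k x //|k] := J_cont (B := B) (fun=> measurable0) _ B0 e0.
  apply: filterS => n; congr (_ <= _); congr (J n _); apply/funext => x.
  by rewrite /indic_dist subr0 indicE in_set0 normr0.
Qed.

Let approxC B : approx B -> approx (~` B).
Proof.
move=> aB e e0; have [g [cg g01 H]] := aB e e0.
exists (fun x => 1 - g x); split => [x|x|].
- by apply: cvgB; [exact: cvg_cst|exact: cg].
- by have := g01 x; lra.
- move: H; apply: filterS => n; congr (_ <= _); congr (J n _); apply/funext => x.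
  rewrite /indic_dist !indicE in_setC; case: (x \in B) => /=.
    by rewrite sub0r opprB distrC.
  by rewrite opprB addrCA subrr addr0 sub0r normrN.
Qed.

Let approxU A B : measurable A -> measurable B -> approx A -> approx B ->
  approx (A `|` B).
Proof.
move=> mA mB aA aB e e0; have e20 : 0 < e / 2 by rewrite divr_gt0.
have [g [cg g01 Hg]] := aA _ e20; have [h [ch h01 Hh]] := aB _ e20.
have cgh : continuous (fun x => Num.max (g x) (h x)).
  by move=> x; apply: continuous_max; [exact: cg|exact: ch].
have gh01 x : 0 <= Num.max (g x) (h x) <= 1.
  have /andP[? ?] := g01 x; have /andP[? ?] := h01 x.
  by rewrite le_max ge_max; lra.
exists (fun x => Num.max (g x) (h x)); split => //.
move: Hg Hh; apply: filterS2 => n Hg Hh.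
have [bg bh] := (bmf_dist mA (bmf_approx cg g01), bmf_dist mB (bmf_approx ch h01)).
apply: (@le_trans _ _ (J n (fun x => indic_dist A g x + indic_dist B h x))).
  apply: J_le; [|exact: bmfD|].
    by apply: bmf_dist; [exact: measurableU|exact: bmf_approx].
  move=> x; rewrite /indic_dist !indicE in_setU.
  have := g01 x; have := h01 x.
  by case: (x \in A); case: (x \in B) => /=; rewrite maxEle; case: (leP (g x) (h x)) => gh;
    rewrite ?subrr ?sub0r ?normrN => /andP[? ?] /andP[? ?]; rewrite !ger0_norm; lra.
by rewrite (le_trans (J_add _ bg bh))// [leRHS]splitr lerD.
Qed.

(** The functions min(1, (k+1) h) increase to the indicator of [U], with an error carried by the
    sets where 0 < h < 1/(k+1), which decrease to the empty set. *)
Let approx_open U : open U -> approx U.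
Proof.
move=> /cozero[h [ch h0 ->]] e e0.
pose g k x := Num.min 1 (k.+1%:R * h x).
have cg k : continuous (g k).
  move=> x; apply: (@continuous_min _ _ (fun=> 1) (fun x => k.+1%:R * h x)).
    exact: cvg_cst.
  by apply: cvgMr; exact: ch.
have g01 k x : 0 <= g k x <= 1.
  by rewrite /g le_min ge_min lexx ler01 mulr_ge0.
have mh : measurable_fun setT (h : borel S -> R) by exact: continuous_borel_measurable.
pose B k : set (borel S) := setT `&` h @^-1` `]0, k.+1%:R^-1[.
have mB k : measurable (B k) by exact: mh.
have Bd k : B k.+1 `<=` B k.
  move=> x [_] /=; rewrite !in_itv/= => /andP[hx hk]; split => //=.
  by rewrite in_itv/= hx/= (lt_le_trans hk)// lef_pV2 ?posrE// ler_nat.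
have B0 : \bigcap_k B k = set0.
  apply/seteqP; split => // x Bx.
  have hx0 : 0 < h x by have [_] := Bx 0%N I; rewrite /= in_itv => /andP[].
  have [_] := Bx (Num.truncn (h x)^-1) I; rewrite /= in_itv /= hx0 /=.
  rewrite ltNge -[leRHS]invrK lef_pV2 ?posrE ?invr_gt0// => /negP; apply.
  by rewrite ltW// truncnS_gt.
have [k H] := J_cont mB Bd B0 e0.
- exists (g k); split => //; apply: filterS H => n H.
  rewrite (le_trans _ H)//; apply: J_le.
  + apply: bmf_dist; last exact: bmf_approx.
    have -> : [set x | 0 < h x] = setT `&` h @^-1` `]0, +oo[.
      by rewrite setTI; apply/seteqP; split => x /=; rewrite in_itv/= andbT.
    exact: mh.
  + exact: bmf_indic.
  + move=> x; rewrite /indic_dist !indicE /g /B setTI.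
    have [hx|hx] := ltP 0 (h x); last first.
      have -> : (x \in [set x | 0 < h x]) = false.
        by apply/negbTE; rewrite notin_setE /=; apply/negP; rewrite -leNgt.
      have -> : h x = 0 by apply/eqP; rewrite eq_le hx h0.
      by rewrite mulr0 min_r// subrr normr0.
    rewrite mem_set//=; have [hk|hk] := ltP (h x) k.+1%:R^-1.
      rewrite mem_set/= ?in_itv/= ?hx//.
      by have := g01 k x; rewrite /g => /andP[? ?]; rewrite ger0_norm; lra.
    rewrite min_l ?subrr ?normr0//.
    by rewrite -[leLHS](@mulfV _ (k.+1%:R)) ?pnatr_eq0// ler_wpM2l.
Qed.

Lemma borel_approx (B : set (borel S)) : measurable B -> approx B.
Proof.
suff : measurable `<=` [set B : set (borel S) | measurable B /\ approx B].
  by move=> H /H [].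
apply: smallest_sub; last first.
  by move=> U oU; split; [exact: sub_sigma_algebra|exact: approx_open].
split.
- by split; [exact: measurable0|exact: approx0].
- by move=> A [mA aA]; rewrite setTD; split; [exact: measurableC|exact: approxC].
suff H (A : nat -> set (borel S)) : (forall k, measurable (A k) /\ approx (A k)) ->
    measurable (\bigcup_k A k) /\ approx (\bigcup_k A k) by move=> A; exact: (H A).
move=> HA; have mA k : measurable (A k) by have [] := HA k.
have mU : measurable (\bigcup_k A k) by exact: bigcupT_measurable.
split => // e e0; have e20 : 0 < e / 2 by rewrite divr_gt0.
(* Finite unions are reached by iterating [approxU]; what they miss of the full union decreases to
   the empty set, so [J_cont] makes it small for all large [n]. *)
pose F k := \big[setU/set0]_(i < k) A i.
have mF k : measurable (F k) by exact: bigsetU_measurable.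
have aF k : approx (F k).
  elim: k => [|k IH]; first by rewrite /F big_ord0; exact: approx0.
  by rewrite /F big_ord_recr /=; exact: (approxU (mF k) (mA k) IH (HA k).2).
pose D k := \bigcup_k A k `\` F k.
have mD k : measurable (D k) by exact: measurableD.
have Dd k : D k.+1 `<=` D k.
  move=> x [Ax Fx]; split => // Fk; apply: Fx.
  by rewrite /F big_ord_recr; left.
have D0 : \bigcap_k D k = set0.
  apply/seteqP; split => // x Dx; have [[i _ Ai] _] := Dx 0%N I.
  have [_ nF] := Dx i.+1 I; apply: nF; rewrite /F big_ord_recr; by right.
have [k Hk] := J_cont mD Dd D0 e20.
have [g [cg g01 Hg]] := aF k _ e20.
exists g; split => //; move: Hk Hg; apply: filterS2 => n Hk Hg.
have bg := bmf_dist (mF k) (bmf_approx cg g01).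
have b1 : bmf (\1_(D k) : borel S -> R) by exact: bmf_indic.
apply: (@le_trans _ _ (J n (fun x => \1_(D k) x + indic_dist (F k) g x))).
  apply: J_le; [by apply: bmf_dist => //; exact: bmf_approx|exact: bmfD|].
  move=> x; rewrite /indic_dist /D !indicE in_setD.
  have FA : x \in F k -> x \in \bigcup_k A k.
    by rewrite !inE; exact: bigsetU_bigcup.
  have := g01 x; move: FA.
  case: (x \in F k) => [->//|_] /=; first by rewrite add0r.
  by case: (x \in _) => /= /andP[? ?]; rewrite ?sub0r ?normrN !ger0_norm; lra.
by rewrite (le_trans (J_add _ b1 bg))// [leRHS]splitr lerD.
Qed.

End borel_approx.

(** * L1 limits of the predictive laws, laws of the variables and stable convergence *)

Section predictive_limit.
Context (R : realType) (S : ptopologicalType).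
Context d (Omega : measurableType d) (P : probability Omega R).
Variables (X : nat -> {RV P >-> borel S}).
Variables (alpha_ : nat -> R.-pker Omega ~> borel S).
Hypothesis halpha : predictive_distributions X alpha_.

Let P1 : P setT = 1%E := probability_setT P.

Definition l1_limit (alpha : R.-pker Omega ~> borel S) :=
  forall B, measurable B -> \int[P]_w
    `|kernel_mean (alpha_ n) \1_B w - kernel_mean alpha \1_B w| @[n --> \oo]
      --> (0 : R).

Let bK k (f : borel S -> R) : bmf f -> bmf (kernel_mean (alpha_ k) f).
Proof. exact: bmf_kernel_mean. Qed.

Lemma expectation_mean (Y : Omega -> R) : bmf Y -> 'E_P[Y]%E = (\int[P]_w Y w)%:E.
Proof. by move=> bY; rewrite unlock mean_EFin. Qed.

Lemma l1_limit_cvg_probability (alpha : R.-pker Omega ~> borel S) (f : borel S -> R) :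
  l1_limit alpha -> bmf f -> exists V : {RV P >-> R},
    cvg_in_probability (fun n => kernel_mean (alpha_ n) f) V.
Proof.
move=> la bf; have bV := bmf_kernel_mean alpha bf.
have [mV _] := bV.
pose V := HB.pack_for {RV P >-> R} (kernel_mean alpha f) (isMeasurableFun.Build _ _ _ _ _ mV).
exists V; apply: l1_cvg_probability => //; first by move=> n; exact: bK.
exact: kernel_l1_cvg.
Qed.

Lemma fine_preimage_X n B : measurable B ->
  \int[P]_w \1_B (X n w) = fine (P (X n @^-1` B)).
Proof.
move=> mB; have mXB : measurable (X n @^-1` B).
  by rewrite -[X in measurable X]setTI; exact: measurable_funPT.
by rewrite -mean_indic.
Qed.

(** The limit [W] need not come from a kernel: the lemma is also applied before the limit kernel
    exists, to make Nikodym's theorem available. *)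
Lemma l1_cvg_law B (W : Omega -> R) : measurable B -> bmf W ->
  \int[P]_w `|kernel_mean (alpha_ n) \1_B w - W w| @[n --> \oo] --> (0 : R) ->
  cvg (P (X n @^-1` B) @[n --> \oo]).
Proof.
move=> mB bW HW; apply/cvg_ex; exists (\int[P]_w W w)%:E.
have b1 : bmf (\1_B : borel S -> R) by exact: bmf_indic.
have mXB n : measurable (X n @^-1` B).
  by rewrite -[X in measurable X]setTI; exact: measurable_funPT.
rewrite (_ : (fun n => _) = fun n => (\int[P]_w kernel_mean (alpha_ n) \1_B w)%:E).
  apply: cvg_EFin; first exact: nearW.
  by apply: l1_cvg_mean1 => // n; exact: bK.
apply/funext => n; rewrite -(predictive_mean1 halpha)// fine_preimage_X// fineK//.
by rewrite prob_fin_num.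
Qed.

Lemma expectation_givenE H (Y : Omega -> R) :
  expectation_given P H Y = (\int[P]_w (\1_H w * Y w)) / fine (P H).
Proof. by rewrite /expectation_given unlock. Qed.

Lemma l1_limit_stable alpha : l1_limit alpha -> cvg_stably X alpha.
Proof.
move=> la f cf bf H mH PH.
have bmf_f : bmf (f : borel S -> R).
  by apply: (@bmfP _ (borel S) R f) => //; exact: continuous_borel_measurable.
rewrite (_ : (fun n => _) =
  fun n => (\int[P]_w (\1_H w * f (X n w))) / fine (P H)); last first.
  by apply/funext => n; rewrite expectation_givenE.
rewrite expectation_givenE; apply: cvgMl.
have bH : bmf (\1_H : Omega -> R) by exact: bmf_indic.
apply/(stable_predictive halpha _ bmf_f bH).
apply: l1_cvg_mean => //; [by move=> n; exact: bK|exact: bmf_kernel_mean|].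
exact: kernel_l1_cvg.
Qed.

Lemma l1_limit_cvg_sqr alpha (f : borel S -> R) : l1_limit alpha -> bmf f ->
  'E_P[(fun w => kernel_mean (alpha_ n) f w ^+ 2)%R]%E @[n --> \oo]
    --> 'E_P[(fun w => kernel_mean alpha f w ^+ 2)%R]%E.
Proof.
move=> la bf; have bV := bmf_kernel_mean alpha bf.
rewrite expectation_mean; last exact: bmf_sqr.
rewrite (_ : (fun n => _) =
    fun n => (\int[P]_w (kernel_mean (alpha_ n) f w ^+ 2))%:E); last first.
  by apply/funext => n; rewrite expectation_mean//; exact/bmf_sqr/bK.
apply: cvg_EFin; first exact: nearW.
have [_ [K fK]] := bf.
apply: (@l1_cvg_sqr _ _ _ _ _ _ K) => //.
- by move=> n; exact: bK.
- by move=> n w; exact: kernel_mean_bound.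
- by move=> w; exact: kernel_mean_bound.
- exact: kernel_l1_cvg.
Qed.

Lemma mean_kernel_cvg0 (alpha : R.-pker Omega ~> borel S) (B : nat -> set (borel S)) :
  (forall k, measurable (B k)) -> (forall k, B k.+1 `<=` B k) ->
  \bigcap_k B k = set0 ->
  \int[P]_w kernel_mean alpha \1_(B k) w @[k --> \oo] --> (0 : R).
Proof.
move=> mB Bd B0.
have b1 k : bmf (\1_(B k) : borel S -> R) by exact: bmf_indic.
rewrite -[X in _ --> X](@mean_cst _ _ _ P P1 0).
apply: (@mean_bounded_cvg _ _ _ _ _ _ 1).
- by move=> k; exact: bmf_kernel_mean.
- exact: bmf_cst.
- move=> k w; apply: kernel_mean_bound => // x; rewrite indicE.
  by case: (_ \in _); rewrite ?normr1 ?normr0.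
- move=> w; rewrite (_ : (fun k => _) = fun k => fine (alpha w (B k))).
    by apply: fine_cvg_measure0 => //; exact: prob_kernel.
  by apply/funext => k; rewrite kernel_mean_indic.
Qed.

Lemma law_cvg_tight :
  (forall B : set (borel S), measurable B -> cvg (P (X n @^-1` B) @[n --> \oo])) ->
  forall B : nat -> set (borel S), (forall k, measurable (B k)) ->
  (forall k, B k.+1 `<=` B k) -> \bigcap_k B k = set0 ->
  forall e : R, 0 < e ->
  exists k, \forall n \near \oo, \int[P]_w \1_(B k) (X n w) <= e.
Proof.
move=> hcvg B mB Bd B0 e e0.
(* The given convergence is in the extended reals; the limit lies between 0 and 1, so it passes to
   real values. *)
have H A : measurable A ->
    fine (P (X n @^-1` A)) @[n --> \oo] --> limn (fun n => fine (P (X n @^-1` A))).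
  move=> mA; have mXA n : measurable (X n @^-1` A).
    by rewrite -[X in measurable X]setTI; exact: measurable_funPT.
  have cv := hcvg A mA.
  have ge0l : (0 <= limn (fun n => P (X n @^-1` A)))%E.
    by apply: lime_ge => //; exact: nearW.
  have le1 : (limn (fun n => P (X n @^-1` A)) <= 1)%E.
    by apply: lime_le => //; apply: nearW => n; exact: probability_le1.
  have fl : (limn (fun n => P (X n @^-1` A)) \is a fin_num)%E.
    by rewrite ge0_fin_numE// (le_lt_trans le1)// ltey.
  apply/cvg_ex; exists (fine (limn (fun n => P (X n @^-1` A)))).
  suff /fine_cvgP[_] : P (X n @^-1` A) @[n --> \oo] -->
     (fine (limn (fun n => P (X n @^-1` A))))%:E by [].
  by rewrite fineK.
have [k Hk] := @nikodym_convergence _ _ R (fun n => distribution P (X n)) _ B e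
  (fun n => probability_setT _) H mB Bd B0 e0.
by exists k; apply: filterS Hk => n; rewrite fine_preimage_X.
Qed.

Hypothesis cozero : forall U : set S, open U ->
  exists h : S -> R, [/\ continuous h, forall x, 0 <= h x & U = [set x | 0 < h x]].

Lemma stable_l1_limit (alpha : R.-pker Omega ~> borel S) :
  (forall B : set (borel S), measurable B -> cvg (P (X n @^-1` B) @[n --> \oo])) ->
  cvg_stably X alpha ->
  (forall f : S -> R, continuous f -> bounded_fun f ->
       'E_P[(fun w => kernel_mean (alpha_ n) f w ^+ 2)%R]%E @[n --> \oo]
         --> 'E_P[(fun w => kernel_mean alpha f w ^+ 2)%R]%E) ->
  l1_limit alpha.
Proof.
move=> hcvg hst hsq.
have bV (f : borel S -> R) : bmf f -> bmf (kernel_mean alpha f) := @bmf_kernel_mean _ _ _ _ _ _ _.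
have bX n (f : borel S -> R) (bf : bmf f) : bmf (fun w => f (X n w)) := bmf_X X n bf.
have cont (f : S -> R) : continuous f -> bmf (f : borel S -> R) ->
    \int[P]_w `|kernel_mean (alpha_ n) f w - kernel_mean alpha f w| @[n --> \oo]
      --> (0 : R).
  move=> cf bf; have [_ [K fK]] := bf.
  apply: (@weak_l2_cvg_l1 _ _ _ _ _ _ K).
  - by move=> n; exact: bK.
  - exact: bV.
  - by move=> n w; exact: kernel_mean_bound.
  - by move=> w; exact: kernel_mean_bound.
  - move=> H mH; have bH : bmf (\1_H : Omega -> R) by exact: bmf_indic.
    apply/(stable_predictive halpha _ bf bH).
    (* Stable convergence says nothing about null events, where all the integrals are 0. *)
    have [PH|PH] := eqVneq (P H) 0%E.
      have z (Y : Omega -> R) : bmf Y -> \int[P]_w (\1_H w * Y w) = 0.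
        move=> bY; have [_ [C YC]] := bY; apply/eqP; rewrite -normr_le0.
        apply: (le_trans (norm_mean_le P1 _)); first exact: bmfM.
        apply: (@le_trans _ _ (\int[P]_w (C * \1_H w))); last first.
          have H0 : \int[P]_w \1_H w = 0 by rewrite mean_indic//; exact: (congr1 fine PH).
          by rewrite meanZ// H0 mulr0.
        apply: le_mean => //; [exact/bmf_norm/bmfM|exact: bmfZ|].
        move=> w; rewrite normrM mulrC ler_pM// indicE.
        by case: (_ \in _); rewrite ?normr1 ?normr0.
      rewrite z; last exact: bV.
      rewrite (_ : (fun n => _) = (fun _ => 0)); first exact: cvg_cst.
      by apply/funext => n; rewrite z//; exact: bX.
    have PH0 : (0 < P H)%E by rewrite lt_neqAle eq_sym PH/=.
    have fPH : 0 < fine (P H) by rewrite fine_gt0// PH0/= ltey_eq prob_fin_num.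
    have := hst f cf (bmf_bounded bf) H mH PH0.
    rewrite expectation_givenE (_ : (fun n => _) =
      fun n => (\int[P]_w (\1_H w * f (X n w))) / fine (P H)); last first.
      by apply/funext => n; rewrite expectation_givenE.
    move=> /(@cvgMl _ _ _ _ _ _ (fine (P H))).
    rewrite divfK ?gt_eqF// (_ : (fun n => _) =
      fun n => (\int[P]_w (\1_H w * f (X n w))))//.
    by apply/funext => n; rewrite /= divfK ?gt_eqF.
  - have := hsq f cf (bmf_bounded bf).
    rewrite expectation_mean; last exact/bmf_sqr/bV.
    rewrite (_ : (fun n => _) =
      fun n => (\int[P]_w (kernel_mean (alpha_ n) f w ^+ 2))%:E); last first.
      by apply/funext => n; rewrite expectation_mean//; exact/bmf_sqr/bK.
    by move/fine_cvgP => [].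
(* Adding the two laws makes a single continuous [g] approximate the indicator of [B] both along the
   [X n] and under [alpha]. *)
pose J n (f : borel S -> R) := \int[P]_w f (X n w) + \int[P]_w kernel_mean alpha f w.
have J_le n f g : bmf f -> bmf g -> (forall x, f x <= g x) -> J n f <= J n g.
  move=> bf bg fg; apply: lerD; first by apply: le_mean => //; exact: bX.
  apply: le_mean; [exact: P1|exact: bV|exact: bV|].
  by move=> w; apply: le_mean => //; exact: prob_kernel.
have J_add n f g : bmf f -> bmf g -> J n (fun x => f x + g x) <= J n f + J n g.
  move=> bf bg; rewrite /J addrACA -(meanD P1 (bX n f bf) (bX n g bg)).
  rewrite -(meanD P1 (bV f bf) (bV g bg)) le_eqVlt; apply/orP; left; apply/eqP.
  by congr (_ + _); apply: eq_Rintegral => w _; exact: kernel_meanD.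
have J_cont (B : nat -> set (borel S)) : (forall k, measurable (B k)) ->
    (forall k, B k.+1 `<=` B k) -> \bigcap_k B k = set0 ->
    forall e : R, 0 < e -> exists k, \forall n \near \oo, J n \1_(B k) <= e.
  move=> mB Bd B0 e e0; have e20 : 0 < e / 2 by rewrite divr_gt0.
  have [k Hk] := law_cvg_tight hcvg mB Bd B0 e20.
  have /cvg0P/(_ _ e20)[N _ HN] := mean_kernel_cvg0 alpha mB Bd B0.
  have b1 i : bmf (\1_(B i) : borel S -> R) by exact: bmf_indic.
  exists (maxn k N); apply: filterS Hk => n Hk.
  have := HN (maxn k N) (leq_maxr _ _); rewrite /= => HN'.
  rewrite [leRHS]splitr lerD//; last exact: le_trans (ler_norm _) HN'.
  rewrite (le_trans _ Hk)//; apply: le_mean; [exact: P1|exact: bX|exact: bX|].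
  have Bmono : B (maxn k N) `<=` B k.
    apply/subsetPset; have /nonincreasing_seqP : forall i, (B i >= B i.+1)%O.
      by move=> i; exact/subsetPset.
    by apply; rewrite leq_maxl.
  move=> w; rewrite !indicE; case: (boolP (X n w \in B (maxn k N))) => [|_].
    by move=> /set_mem/Bmono/mem_set ->.
  exact: ler0n.
move=> B mB; apply/cvg0P => e e0.
have e40 : 0 < e / 4 by rewrite divr_gt0.
have [g [cg g01 Hg]] := borel_approx J_le J_add J_cont cozero mB e40.
have bg : bmf (g : borel S -> R).
  apply: (@bmf_continuous _ _ _ 1) => // x.
  by have /andP[? ?] := g01 x; rewrite ger0_norm.
have b1 : bmf (\1_B : borel S -> R) by exact: bmf_indic.
have bd : bmf (indic_dist B g : borel S -> R) by exact/bmf_norm/bmfB.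
have /cvg0P/(_ _ e40) := cont g cg bg.
apply: filterS2 Hg => n Hg Hc.
have D (a : R.-pker Omega ~> borel S) w :
    `|kernel_mean a \1_B w - kernel_mean a g w| <= kernel_mean a (indic_dist B g) w.
  rewrite -kernel_meanB//; apply: norm_mean_le; first exact: prob_kernel.
  exact: bmfB.
have I0 : 0 <= \int[P]_w kernel_mean alpha (indic_dist B g) w.
  by apply: mean_ge0 => w; apply: mean_ge0 => x; exact: normr_ge0.
have I1 : 0 <= \int[P]_w indic_dist B g (X n w).
  by apply: mean_ge0 => w; exact: normr_ge0.
rewrite ger0_norm ?mean_ge0//.
(* Comparison through [g]: the first and last terms integrate to [J n (indic_dist B g)], because the
   n-th predictive law has the law of [X n] as its mean; the middle one is the continuous case
   [cont]. *)
apply: (@le_trans _ _ (\int[P]_w (kernel_mean (alpha_ n) (indic_dist B g) w +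
    (`|kernel_mean (alpha_ n) g w - kernel_mean alpha g w| +
      kernel_mean alpha (indic_dist B g) w)))).
  apply: le_mean.
  - exact: P1.
  - by apply/bmf_norm/bmfB; [exact: bK|exact: bV].
  - apply: bmfD; first exact: bK.
    by apply: bmfD; [apply/bmf_norm/bmfB; [exact: bK|exact: bV]|exact: bV].
  - move=> w; have := D (alpha_ n) w; have := D alpha w.
    set a := kernel_mean alpha \1_B w; set b := kernel_mean alpha (g : borel S -> R) w.
    set a' := kernel_mean (alpha_ n) \1_B w.
    set b' := kernel_mean (alpha_ n) (g : borel S -> R) w => H1 H2.
    rewrite (_ : a' - a = (a' - b') + ((b' - b) - (a - b))); last by lra.
    rewrite (le_trans (ler_normD _ _))// lerD//.
    by rewrite (le_trans (ler_normB _ _))// lerD.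
have bKV : bmf (fun w => `|kernel_mean (alpha_ n) g w - kernel_mean alpha g w|).
  by apply/bmf_norm/bmfB; [exact: bK|exact: bV].
have [bKd bVd] := (bK n bd, bV _ bd).
rewrite meanD//; last exact: bmfD.
rewrite meanD//.
rewrite -(predictive_mean1 halpha)//.
move: Hg Hc; rewrite /J ger0_norm ?mean_ge0//; lra.
Qed.

End predictive_limit.

(** * Standard Borel spaces are measurable retracts of the line *)

(* Base 4 rather than 2, so that the digits of the code are unambiguous. *)
Section quaternary_code.
Context d (T : measurableType d) (R : realType) (b : nat -> T -> bool).
Hypothesis mb : forall n, measurable [set x | b n x].

Fixpoint code_prefix n x : nat := if n is m.+1 then 4 * code_prefix m x + b m x else 0.

Let s n x : R := (code_prefix n x)%:R / 4 ^+ n.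

Definition code (x : T) : R := limn (s ^~ x).

(** The base 4 digits of a code are 0 or 1, so each is recovered as the parity of the integer part
    of [4 ^+ n.+1 * t]. *)
Definition digit n : set R :=
  \bigcup_(K in [set K | odd K]) [set t | K%:R <= 4 ^+ n.+1 * t < K.+1%:R].

Let sS n x : s n.+1 x = s n x + (b n x)%:R / 4 ^+ n.+1.
Proof.
rewrite /s /= natrD natrM mulrDl; congr (_ + _).
by rewrite exprS invfM mulrACA divff ?mul1r// pnatr_eq0.
Qed.

(** The constant 1/3 is the sum of 4^-i over i >= 1, so [3^-1 / 4 ^+ n] bounds the contribution of
    all digits after the first [n]. It stays below [1 / 4 ^+ n], which prevents the tail from
    altering the digits already written. *)
Let s_tail n m x : (n <= m)%N ->
  s n x <= s m x /\ s m x + 3^-1 / 4 ^+ m <= s n x + 3^-1 / 4 ^+ n.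
Proof.
move=> nm; rewrite -(subnK nm); elim: (m - n)%N => [//|k [IH1 IH2]].
rewrite addSn sS exprS; set j := (k + n)%N in IH1 IH2 *.
have p : 0 < (4 ^+ j : R)^-1 by rewrite invr_gt0 exprn_gt0.
have b01 : 0 <= ((b j x)%:R : R) <= 1 by rewrite ler0n lern1 leq_b1.
rewrite invfM; move: (b j x)%:R b01 => /= c /andP[c0 c1].
have h0 : 0 <= c * (4^-1 / 4 ^+ j) by rewrite mulr_ge0// mulr_ge0// ltW.
have h1 : c * (4^-1 / 4 ^+ j) <= 4^-1 / 4 ^+ j.
  by rewrite ler_piMl// mulr_ge0// ltW.
move: h0 h1 p IH1 IH2; move: (4 ^+ j)^-1 (s n x) (s j x) (4 ^+ n)^-1 => q u v r.
by move=> *; split; lra.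
Qed.

Let s_cvg x : cvgn (s ^~ x).
Proof.
apply: nondecreasing_is_cvgn.
  by move=> n m nm; have [] := s_tail x nm.
exists (s 0 x + 3^-1 / 4 ^+ 0) => _ [m _ <-].
have [_ H] := s_tail x (leq0n m); apply: le_trans H.
by rewrite lerDl mulr_ge0// invr_ge0 exprn_ge0.
Qed.

Let code_bound n x : s n x <= code x <= s n x + 3^-1 / 4 ^+ n.
Proof.
apply/andP; split.
  apply: limr_ge; [exact: s_cvg|exists n => // m /= nm].
  by have [] := s_tail x nm.
apply: limr_le; [exact: s_cvg|exists n => // m /= nm].
have [_ H] := s_tail x nm; apply: le_trans H.
by rewrite lerDl mulr_ge0// invr_ge0 exprn_ge0.
Qed.

Lemma code_itv x : 0 <= code x <= 1.
Proof.
by have := code_bound 0 x; rewrite /s /= expr0 !divr1 => /andP[c0 c1]; lra.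
Qed.

Lemma digit_code n x : digit n (code x) <-> b n x.
Proof.
have p : 0 < (4 ^+ n.+1 : R) by rewrite exprn_gt0.
have := code_bound n.+1 x; rewrite /s -mulrDl ler_pdivrMr// ler_pdivlMr// mulrC.
set K := code_prefix n.+1 x => /andP[K1 K2].
have oddK : odd K = b n x by rewrite /K /= oddD oddM /=; case: (b n x).
have K3 : 4 ^+ n.+1 * code x < K.+1%:R by rewrite -[K.+1%:R]natr1; lra.
split=> [[K' /= oK' /andP[K'1 K'2]]|bn]; last first.
  by exists K; rewrite /= ?oddK// K1.
rewrite -oddK (_ : K = K')//; apply/eqP; rewrite eqn_leq.
have := le_lt_trans K1 K'2; have := le_lt_trans K'1 K3.
by rewrite !ltr_nat !ltnS => -> ->.
Qed.

Lemma measurable_code : measurable_fun setT code.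
Proof.
have mK n : measurable_fun setT (fun x => (code_prefix n x)%:R : R).
  elim: n => [|n IH] /=; first exact: measurable_cst.
  rewrite (_ : (fun _ => _) = fun x => 4 * (code_prefix n x)%:R + \1_[set x | b n x] x).
    apply: measurable_funD; last exact: measurable_indic.
    by apply: measurable_funM => //; exact: measurable_cst.
  apply/funext => x; rewrite natrD natrM indicE; congr (_ + _%:R).
  by rewrite mem_setE.
apply: (@measurable_fun_cvg _ _ _ _ s) => [n|x _]; last exact: s_cvg.
by apply: measurable_funM => //; exact: measurable_cst.
Qed.

End quaternary_code.

Lemma measurable_digit (R : realType) n : measurable (digit n : set R).
Proof.
apply: bigcup_measurable => K _.
rewrite (_ : [set t | _] = setT `&` (fun t : R => 4 ^+ n.+1 * t) @^-1` `[K%:R, K.+1%:R[).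
  have mf : measurable_fun setT (fun t : R => 4 ^+ n.+1 * t).
    by apply: measurable_funM => //; exact: measurable_cst.
  exact: mf.
by rewrite setTI; apply/seteqP; split => t /=; rewrite in_itv.
Qed.

(** Take the least admissible index: [F j] is the set where it equals [j]. *)
Lemma measurable_selection d (T : measurableType d) (A : nat -> set T) :
  (forall j, measurable (A j)) ->
  exists2 J : T -> nat, (forall j, measurable [set t | J t = j]) &
    forall t, (exists j, A j t) -> A (J t) t.
Proof.
move=> mA.
pose F j := A j `\` \big[setU/set0]_(i < j) A i.
have mF j : measurable (F j) by apply: measurableD => //; exact: bigsetU_measurable.
have trF : trivIset setT F by exact: trivIset_seqDU.
exists (fun t => xget 0%N [set j | F j t]); last first.
  move=> t [j Aj]; have : (\bigcup_j F j) t.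
    by rewrite -[X in X t]/(\bigcup_j seqDU A j) -seqDU_bigcup_eq; exists j.
  by move=> [i _ Fi]; case: xgetP => [k _ []//|/(_ i)].
move=> j.
have E t : F j t -> xget 0%N [set j | F j t] = j.
  move=> Fj; case: xgetP => [k _ /= Fk|/(_ j)//].
  by apply: trF => //; exists t.
(* The value 0 is also the default, so its level set contains the points that lie in no [A j]. *)
have [->|j0] := eqVneq j 0%N.
  rewrite (_ : [set t | _] = F 0%N `|` ~` (\bigcup_j F j)).
    by apply: measurableU => //; apply: measurableC; exact: bigcupT_measurable.
  apply/seteqP; split => t /=.
    case: xgetP => [k -> Fk k0|nF _]; first by left; rewrite -k0.
    by right => -[i _ Fi]; exact: (nF i).
  move=> [Ft|nF].
    case: xgetP => [k _ /= Fk|//].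
    by apply: trF => //; exists t.
  by case: xgetP => [k _ /= Fk|//]; exfalso; apply: nF; exists k.
rewrite (_ : [set t | _] = F j)//; apply/seteqP; split => t /=; last exact: E.
by case: xgetP => [k -> /= Fk <-//|_ j0']; rewrite -j0' eqxx in j0.
Qed.

Section separable_metric.
Context (R : realType) (M : completeMetricType R).

Lemma mball_open (x : M) (r : R) : open [set y : M | mdist x y < r].
Proof.
rewrite openE => y /= xy; rewrite /interior -metricType_numDomainType.nbhs_nbhs_mdist.
exists (r - mdist x y) => /=; first by rewrite subr_gt0.
move=> z /= yz; rewrite (le_lt_trans (metric_triangle x y z))//.
by rewrite -ltrBrDl.
Qed.

Lemma mdist_continuous (x : M) : continuous (mdist x : M -> R).
Proof.
move=> y; apply/cvgrPdist_le => e e0.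
have : \forall z \near y, mdist y z < e.
  by rewrite metricType_numDomainType.nbhs_mdistP; exists e.
apply: filterS => z yz.
have := metric_triangle x y z; have := metric_triangle x z y.
by rewrite (metric_sym z y) ler_distl; lra.
Qed.

Lemma dense_sequence : separable_space M ->
  exists e : nat -> M, forall y (r : R), 0 < r -> exists j, mdist (e j) y < r.
Proof.
move=> [D /countable_injP[f injf] dD].
(* Integers that the numbering [f] of [D] does not reach receive [point]. *)
exists (fun n => xget point [set x | D x /\ f x = n]) => y r r0.
have [x [/= yx Dx]] := dD _ (ex_intro _ y (ltac:(by rewrite /= mdistxx) : [set z | mdist y z < r] y))
  (mball_open y r).
exists (f x); case: xgetP => [z _ [Dz fz]|/(_ x) H]; last by exfalso; exact: H.
by rewrite (injf _ _ _ _ fz) ?inE// metric_sym.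
Qed.

Lemma geometric_cauchy_cvg (u : nat -> M) :
  (forall k, mdist (u k) (u k.+1) <= 2 / 2 ^+ k) -> cvgn u.
Proof.
move=> du; apply: cauchy_cvg; apply: cauchy_exP => e e0.
(* The right-hand side is the exact geometric sum of the steps [2 / 2 ^+ i] for i from k to
   k+m-1. *)
have dkm k m : mdist (u k) (u (k + m)%N) <= 4 / 2 ^+ k - 4 / 2 ^+ (k + m).
  elim: m => [|m IH]; first by rewrite addn0 mdistxx subrr.
  rewrite (le_trans (metric_triangle _ (u (k + m)%N) _))// addnS.
  rewrite (le_trans (lerD IH (du _)))// exprS invfM.
  by move: (2 ^+ k)^-1 (2 ^+ (k + m))^-1 => a b; lra.
have [k ke] : exists k, 4 / 2 ^+ k < e :> R.
  have [k _ /(_ k (leqnn k)) /= H] : \forall k \near \oo, `|0 - 2^-1 ^+ k| < e / 4.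
    have /cvgrPdist_lt : (fun k => 2^-1 ^+ k : R) @ \oo --> (0 : R).
      by apply: cvg_expr; rewrite ger0_norm ?invr_ge0// invf_lt1// ltr1n.
    by apply; rewrite divr_gt0.
  exists k; move: H; rewrite sub0r normrN ger0_norm ?exprn_ge0 ?invr_ge0//.
  by rewrite exprVn; lra.
exists (u k); exists k => // n /= kn; rewrite ballEmdist /=.
rewrite -(subnKC kn) (le_lt_trans (dkm _ _))// (le_lt_trans _ ke)//.
by rewrite gerBl mulr_ge0// invr_ge0 exprn_ge0.
Qed.

(** An open set is a countable union of balls with centres in a dense sequence and radii 1/(k+1),
    and the preimage of such a ball is read off from one distance function. *)
Lemma measurable_borel_dist d (T : measurableType d) (psi : T -> M) :
  separable_space M -> (forall p, measurable_fun setT (fun t => mdist p (psi t))) ->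
  measurable_fun setT (psi : T -> borel M).
Proof.
move=> /dense_sequence[e he] mpsi.
apply: (@measurability _ _ _ (borel M) setT psi (@open M)) => // _ [V oV <-]; rewrite setTI.
rewrite (_ : psi @^-1` V = \bigcup_(j in setT)
  \bigcup_(k in [set k | [set y | mdist (e j) y < k.+1%:R^-1] `<=` V])
    [set t | mdist (e j) (psi t) < k.+1%:R^-1]).
  apply: bigcupT_measurable => j; apply: bigcup_measurable => k _.
  rewrite (_ : [set t | _] = setT `&` (fun t => mdist (e j) (psi t)) @^-1` `]-oo, k.+1%:R^-1[).
    exact: mpsi.
  by rewrite setTI; apply/seteqP; split => t /=; rewrite in_itv.
apply/seteqP; split => t /= => [Vt|[j _ [k /= kV]]]; last exact: kV.
have : nbhs (psi t) V by apply: open_nbhs_nbhs.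
rewrite -metricType_numDomainType.nbhs_nbhs_mdist => -[r /= r0 rV].
pose k := Num.truncn (2 / r).
have kr : 2 * k.+1%:R^-1 < r.
  by rewrite ltr_pdivrMr ?ltr0n// mulrC -ltr_pdivrMr// truncnS_gt.
have k0 : 0 < k.+1%:R^-1 :> R by rewrite invr_gt0.
have [j jk] := he (psi t) _ k0.
exists j => //; exists k => //= y /= jy; apply: rV => /=.
rewrite (le_lt_trans (metric_triangle _ (e j) _))// (metric_sym (psi t)).
by apply: lt_trans kr; rewrite mulr_natl mulr2n ltrD.
Qed.

(** [phi] stores in its digits, for all [k] and [j], whether the point is within 2^-k of [e j].
    [psi] selects for each [k] a centre so marked; for the code of [y] these centres converge to
    [y]. *)
Lemma polish_retract : separable_space M ->
  exists (phi : borel M -> R) (psi : R -> borel M),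
    [/\ measurable_fun setT phi, forall y, 0 <= phi y <= 1,
      measurable_fun setT psi & cancel phi psi].
Proof.
move=> sM; have [e he] := dense_sequence sM.
pose b (n : nat) (y : borel M) : bool :=
  if unpickle n is Some (k, j) then mdist (e j) y < (2 ^+ k)^-1 else false.
have mb n : measurable [set y | b n y].
  rewrite /b; case: (unpickle n) => [[k j]|].
    by apply: sub_sigma_algebra; exact: mball_open.
  rewrite (_ : [set _ | _] = set0); first exact: measurable0.
  by apply/seteqP; split.
have exJ (k : nat) : exists J : R -> nat, (forall j, measurable [set t | J t = j]) /\
    forall t, (exists j : nat, digit (pickle (k, j)) t) -> digit (pickle (k, J t)) t.
  have [J mJ JP] := @measurable_selection _ R (fun j => digit (pickle (k, j)))
    (fun j => measurable_digit _).
  by exists J.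
have [J HJ] := choice exJ.
pose u (t : R) k := e (J k t).
(* Arbitrary reals need not be codes: [G] is a measurable set on which the selected centres form a
   Cauchy sequence. It contains every code, since consecutive centres are then near the same [y]:
   2^-k + 2^-(k+1) <= 2 * 2^-k. *)
pose G := \bigcap_k [set t | mdist (u t k) (u t k.+1) <= 2 / 2 ^+ k].
have mG : measurable G.
  apply: bigcapT_measurable => k.
  rewrite (_ : [set t | _] = \bigcup_i \bigcup_(j in [set j | mdist (e i) (e j) <= 2 / 2 ^+ k])
     ([set t | J k t = i] `&` [set t | J k.+1 t = j])).
    apply: bigcupT_measurable => i; apply: bigcup_measurable => j _.
    by apply: measurableI; [have [] := HJ k|have [] := HJ k.+1].
  apply/seteqP; split => t /=.
    by move=> H; exists (J k t) => //; exists (J k.+1 t).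
  by move=> [i _ [j /= ij [Ji Jj]]]; rewrite /u Ji Jj.
pose psi (t : R) : M := if t \in G then limn (u t) else point.
have cvgG t : G t -> u t @ \oo --> psi t.
  move=> Gt; rewrite /psi mem_set//.
  by apply: geometric_cauchy_cvg => k; exact: Gt.
have mpsi : measurable_fun setT (psi : R -> borel M).
  apply: measurable_borel_dist => // p.
  (* Off [G] the centres need not converge, so there the approximations are replaced by the constant
     [mdist p point]. *)
  pose h k t := \1_G t * mdist p (u t k) + \1_(~` G) t * mdist p point.
  apply: (@measurable_fun_cvg _ _ _ _ h) => [k|t _].
    apply: measurable_funD; last first.
      apply: measurable_funM; last exact: measurable_cst.
      by apply: measurable_indic; exact: measurableC.
    apply: measurable_funM; first exact: measurable_indic.
    move=> _ Y mY; rewrite setTI.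
    rewrite (_ : _ @^-1` Y = \bigcup_(j in [set j | Y (mdist p (e j))]) [set t | J k t = j]).
      by apply: bigcup_measurable => j _; have [] := HJ k.
    apply/seteqP; split => s /=; first by move=> H; exists (J k s).
    by move=> [j /= H Jj]; rewrite /u Jj.
  rewrite /h !indicE in_setC; have [tG|tG] := boolP (t \in G) => /=; last first.
    rewrite (_ : (fun k => _) = fun _ => mdist p (psi t)); first exact: cvg_cst.
    by apply/funext => k; rewrite mul0r mul1r add0r /psi (negbTE tG).
  rewrite (_ : (fun k => _) = (mdist p \o u t)); last first.
    by apply/funext => k; rewrite mul0r mul1r addr0.
  apply: (@cvg_comp _ _ _ (u t) (mdist p) _ (nbhs (psi t))); last exact: mdist_continuous.
  by apply: cvgG; exact: set_mem.
exists (code R b), psi; split => //; [exact: measurable_code|by move=> y; exact: code_itv|].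
move=> y; pose t : R := code R b y.
have uy k : mdist (u t k) y < (2 ^+ k)^-1.
  have D j : digit (pickle (k, j)) t <-> mdist (e j) y < (2 ^+ k)^-1.
    by rewrite digit_code /b pickleK.
  apply/D; have [_] := HJ k; apply.
  have [j jy] := he y (2 ^+ k)^-1 (ltac:(by rewrite invr_gt0 exprn_gt0)).
  by exists j; apply/D.
have Gt : G t.
  move=> k _ /=; rewrite (le_trans (metric_triangle _ y _))//.
  have := uy k; have := uy k.+1; rewrite (metric_sym y) exprS invfM.
  have : 0 < (2 ^+ k : R)^-1 by rewrite invr_gt0 exprn_gt0.
  by move: (2 ^+ k)^-1 => a; lra.
apply: (cvg_unique (@metric_hausdorff _ M) (cvgG _ Gt)).
apply/metricType_numDomainType.cvgrPdist_lt => r r0.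
have /cvgrPdist_lt/(_ r r0) : (fun k => 2^-1 ^+ k : R) @ \oo --> (0 : R).
  by apply: cvg_expr; rewrite ger0_norm ?invr_ge0// invf_lt1// ltr1n.
apply: filterS => k; rewrite sub0r normrN ger0_norm ?exprn_ge0 ?invr_ge0// exprVn.
by rewrite metric_sym; apply: lt_trans.
Qed.

End separable_metric.

Lemma preimage_sigma_algebra (T U : topologicalType) (g : T -> U) (A : set U) :
  continuous g -> <<s @open U >> A -> <<s @open T >> (g @^-1` A).
Proof.
move=> /continuousP cg; move: A.
apply: (@smallest_sub _ (sigma_algebra setT) _ [set A | <<s @open T >> (g @^-1` A)]).
  have [s0 sD sU] := @smallest_sigma_algebra _ setT (@open T).
  split => /=.
  - by rewrite preimage_set0.
  - move=> A sA; have := sD _ sA.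
    by rewrite !setTD preimage_setC.
  - by move=> A sA; rewrite preimage_bigcup; exact: sU.
by move=> V oV; apply: sub_sigma_algebra; exact: cg.
Qed.

Section standard_borel.
Context (R : realType) (S : ptopologicalType) (hS : standard_borel_space R S).

(** [rho] goes from [S] to a Borel subset of the Polish space and on to a complete metric model [M];
    [sec] inverts it on the image and is [point] elsewhere, and it is measurable because the image
    is Borel. The last clause serves to pull cozero functions back from [M] to [S]. *)
Lemma standard_borel_embedding :
  exists (M : completeMetricType R) (rho : S -> M) (sec : borel M -> borel S),
    [/\ separable_space M, continuous rho, cancel rho sec,
      measurable_fun setT sec &
      forall U, open U -> exists2 W, open W & U = rho @^-1` W].
Proof.
have [E [A [[[D cD dD] [M [f [g [cf cg fK gK]]]]] sA [h [h' [ch ch' hK h'K]]]]]] := hS.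
pose rho (x : S) : M := f (set_val (h x)).
pose sec (y : M) : S := if pselect (A (g y)) is left Ag
  then h' (exist _ (g y) (mem_set Ag)) else point.
have openA (U : set S) : open U -> exists2 V, open V & h' @^-1` U = set_val @^-1` V.
  move=> oU; have /continuousP/(_ U oU)[V oV VU] := ch'.
  by exists V.
exists M, rho, sec; split.
- exists (f @` D); first by apply: sub_countable cD; exact: card_image_le.
  move=> O [y Oy] oO; have /continuousP/(_ O oO) ofO := cf.
  have [x [/= Ofx Dx]] := dD _ (ex_intro _ (g y) (ltac:(by rewrite /= gK) : (f @^-1` O) (g y))) ofO.
  by exists (f x); split => //; exists x.
- move=> x; apply: (@continuous_comp _ _ _ (set_val \o h) f); last exact: cf.
  by apply: continuous_comp; [exact: ch|exact: initial_continuous].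
- move=> x; rewrite /sec /rho fK.
  case: pselect => [Ah|]; last by case; apply: set_mem; exact: valP.
  by rewrite -[RHS]hK; congr h'; apply: val_inj.
- apply: (@measurability _ _ (borel M) (borel S) setT sec (@open S)) => // _ [U oU <-].
  rewrite setTI; have [V oV VU] := openA U oU.
  have mgA : measurable (g @^-1` A : set (borel M)) by exact: preimage_sigma_algebra.
  have mgV : measurable (g @^-1` V : set (borel M)).
    by apply: sub_sigma_algebra; move/continuousP : cg; apply.
  have E1 y (Ay : A (g y)) : U (sec y) <-> V (g y).
    rewrite /sec; case: pselect => // Ag.
    by rewrite -[U _]/((h' @^-1` U) _) VU.
  have E2 y (Ay : ~ A (g y)) : sec y = point by rewrite /sec; case: pselect.
  rewrite (_ : sec @^-1` U = (g @^-1` A `&` g @^-1` V) `|`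
     (~` (g @^-1` A) `&` [set _ | U point])).
    apply: measurableU; first exact: measurableI.
    apply: measurableI; first exact: measurableC.
    have [Up|Up] := pselect (U point).
      by rewrite (_ : [set _ | _] = setT)//; apply/seteqP; split.
    by rewrite (_ : [set _ | _] = set0)//; apply/seteqP; split.
  apply/seteqP; split => y /=.
    have [Ay|Ay] := pselect (A (g y)); first by move/(E1 _ Ay); left.
    by rewrite E2//; right.
  by move=> [[Ay Vy]|[Ay Up]]; [exact/(E1 _ Ay)|rewrite E2].
- move=> U oU; have [V oV VU] := openA U oU.
  exists (g @^-1` V); first by move/continuousP : cg; apply.
  apply/seteqP; split => x /=; rewrite /rho fK.
    by rewrite -[V _]/((set_val @^-1` V) _) -VU /= hK.
  by rewrite -[V _]/((set_val @^-1` V) _) -VU /= hK.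
Qed.

Lemma standard_borel_retract :
  exists (phi : borel S -> R) (psi : R -> borel S),
    [/\ measurable_fun setT phi, forall y, 0 <= phi y <= 1,
      measurable_fun setT psi & cancel phi psi].
Proof.
have [M [rho [sec [sM crho secK msec _]]]] := standard_borel_embedding.
have [phi [psi [mphi phi01 mpsi phiK]]] := polish_retract sM.
have mrho : measurable_fun setT (rho : borel S -> borel M).
  apply: (@measurability _ _ (borel S) (borel M) setT rho (@open M)) => // _ [W oW <-].
  by rewrite setTI; apply: sub_sigma_algebra; move/continuousP : crho; apply.
exists (phi \o rho), (sec \o psi); split.
- exact: measurableT_comp.
- by move=> y; exact: phi01.
- exact: measurableT_comp.
- by move=> x /=; rewrite phiK secK.
Qed.

Lemma metric_cozero (M : completeMetricType R) (W : set M) : open W ->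
  exists h : M -> R, [/\ continuous h, forall x, 0 <= h x & W = [set x | 0 < h x]].
Proof.
(* The distance to an empty complement is infinite, so the whole space is treated apart. *)
move=> oW; have [W0|/set0P[a nWa]] := eqVneq (~` W) set0.
  exists (fun _ => 1); split => [x|//|]; first exact: cvg_cst.
  by rewrite -[W]setCK W0 setC0; apply/seteqP; split => x //=.
pose dist := edist_inf (~` W).
have edE (x y : M) : edist (x, y) \is a fin_num.
  apply/edist_finP; exists (mdist x y + 1); first by rewrite ltr_wpDl// mdist_ge0.
  by rewrite /= ballEmdist /= ltrDl.
have finE x : dist x \is a fin_num.
  rewrite ge0_fin_numE ?edist_inf_ge0//.
  apply: (@le_lt_trans _ _ (edist (x, a))); last by rewrite ltey_eq edE.
  by apply: ereal_inf_lbound; exists a.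
exists (fine \o dist); split => [x|x|].
- have /fine_cvgP[_] : dist y @[y --> x] --> (fine (dist x))%:E.
    by rewrite fineK//; exact: edist_inf_continuous.
  exact.
- by rewrite /= fine_ge0// edist_inf_ge0.
- apply/seteqP; split => x /= => [Wx|].
    have : nbhs x W by apply: open_nbhs_nbhs.
    rewrite -metricType_numDomainType.nbhs_nbhs_mdist => -[r /= r0 rW].
    apply: (@lt_le_trans _ _ r) => //; rewrite -lee_fin fineK//.
    apply: le_ereal_inf_tmp => _ [y nWy <-]; rewrite leNgt; apply/negP => xy.
    by apply: nWy; apply: rW => /=; have := edist_lt_ball xy; rewrite ballEmdist.
  move=> x0; apply: contrapT => nWx; move: x0.
  by rewrite /dist edist_inf0//= ltxx.
Qed.

Lemma standard_borel_cozero (U : set S) : open U ->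
  exists h : S -> R, [/\ continuous h, forall x, 0 <= h x & U = [set x | 0 < h x]].
Proof.
have [M [rho [_ [_ crho _ _ HU]]]] := standard_borel_embedding.
move=> /HU[W /metric_cozero[h [ch h0 ->]] ->]; exists (h \o rho); split => // x.
  by apply: continuous_comp; [exact: crho|exact: ch].
exact: h0.
Qed.

End standard_borel.

(** * Construction of the limit kernel *)

Section image_kernel.
Context d d1 d2 (Omega : measurableType d) (U : measurableType d1)
  (S : measurableType d2) (R : realType).
Variables (lam : probability U R) (G : Omega * U -> S).
Hypothesis mG : measurable_fun setT G.

Let mGw w : measurable_fun setT (fun u => G (w, u)).
Proof. exact: measurableT_comp mG (pair1_measurable w). Qed.

Let X w := HB.pack_for {RV lam >-> S} (fun u => G (w, u))
  (isMeasurableFun.Build _ _ _ _ _ (mGw w)).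

Definition image_law (w : Omega) : {measure set S -> \bar R} :=
  distribution lam (X w).

Let measurable_image_law B : measurable B -> measurable_fun setT (image_law ^~ B).
Proof.
move=> mB; have mGB : measurable (G @^-1` B) by rewrite -[X in measurable X]setTI; exact: mG.
have := measurable_fun_xsection lam mGB.
by congr measurable_fun; apply/funext => w /=; rewrite xsectionE.
Qed.

HB.instance Definition _ := isKernel.Build _ _ _ _ _ image_law measurable_image_law.

Let image_law1 w : image_law w setT = 1%E.
Proof. exact: probability_setT. Qed.

HB.instance Definition _ :=
  Kernel_isProbability.Build _ _ _ _ _ image_law image_law1.

Definition image_kernel : R.-pker Omega ~> S := image_law.

Lemma image_kernelE w B : image_kernel w B = lam [set u | B (G (w, u))].
Proof. by []. Qed.

End image_kernel.

Lemma uniform_prob_ray (R : realType) (c : R) : 0 <= c <= 1 ->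
  uniform_prob (@ltr01 R) [set u | u <= c] = c%:E.
Proof.
move=> /andP[c0 c1]; rewrite /uniform_prob integral_uniform_pdf.
rewrite (_ : _ `&` _ = `[0, c]%classic); last first.
  apply/seteqP; split => u /=; rewrite !in_itv/=.
    by move=> [uc /andP[u0 _]]; rewrite u0.
  by move=> /andP[u0 uc]; rewrite u0 (le_trans uc).
rewrite (eq_integral (fun=> 1%E)); last first.
  move=> u; rewrite inE /= in_itv /= /uniform_pdf => /andP[u0 uc].
  by rewrite u0 (le_trans uc c1) subr0 invr1.
by rewrite integral_cst//= mul1e lebesgue_measure_itv/= lte_fin sube0; case: ltP => //; case: (ltgtP c 0) c0 => // -> _.
Qed.

(** * Sets on which the predictive laws converge in L1 *)

Section limit_construction.
Context (R : realType) (S : ptopologicalType).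
Context d (Omega : measurableType d) (P : probability Omega R).
Variables (X : nat -> {RV P >-> borel S}).
Variables (alpha_ : nat -> R.-pker Omega ~> borel S).
Hypothesis halpha : predictive_distributions X alpha_.

Let P1 : P setT = 1%E := probability_setT P.

Definition l1_limit_on (B : set (borel S)) (W : Omega -> R) :=
  [/\ measurable B, bmf W &
    \int[P]_w `|kernel_mean (alpha_ n) \1_B w - W w| @[n --> \oo] --> (0 : R)].

Let bK n (B : set (borel S)) : measurable B -> bmf (kernel_mean (alpha_ n) \1_B).
Proof. by move=> mB; apply: bmf_kernel_mean; exact: bmf_indic. Qed.

Let K01 n (B : set (borel S)) w : measurable B -> 0 <= kernel_mean (alpha_ n) \1_B w <= 1.
Proof.
move=> mB; rewrite kernel_mean_indic// fine_ge0//=.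
have := fine_le_measure (prob_kernel (s := alpha_ n) w) mB measurableT (@subsetT _ B).
by rewrite prob_kernel.
Qed.

(** Probabilities lie in [0, 1], so clamping the limit to that interval only brings it closer to
    them, and boundedness upgrades convergence in probability to L1. *)
Lemma l1_limit_on_clamp B (V : {RV P >-> R}) : measurable B ->
  cvg_in_probability (fun n => kernel_mean (alpha_ n) \1_B) V ->
  exists2 W, l1_limit_on B W & forall w, 0 <= W w <= 1.
Proof.
move=> mB hV; pose W w := Num.max 0 (Num.min 1 (V w)).
have W01 w : 0 <= W w <= 1.
  by rewrite /W le_max lexx /= ge_max ler01 ge_min lexx.
have mW : measurable_fun setT W.
  apply: measurable_maxr; first exact: measurable_cst.
  by apply: measurable_minr; [exact: measurable_cst|exact: measurable_funPT].
have bW : bmf W.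
  by split => //; exists 1 => w; have /andP[? ?] := W01 w; rewrite ger0_norm.
exists W => //; split => //; apply/cvg0P => e e0.
have e20 : 0 < e / 2 by rewrite divr_gt0.
have /fine_cvgP[_ /cvg0P/(_ _ e20)] := hV _ e20; apply: filterS => n /= Hn.
set A := [set w | e / 2 < `|kernel_mean (alpha_ n) \1_B w - V w|] in Hn.
have mA : measurable A.
  rewrite (_ : A = setT `&` (fun w => `|kernel_mean (alpha_ n) \1_B w - V w|) @^-1` `]e / 2, +oo[).
    have mKV : measurable_fun setT (fun w => `|kernel_mean (alpha_ n) \1_B w - V w|).
      apply: measurableT_comp => //; apply: measurable_funB; last exact: measurable_funPT.
      by have [] := bK n mB.
    exact: mKV.
  by rewrite setTI; apply/seteqP; split => w /=; rewrite in_itv/= andbT.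
have bA : bmf (\1_A : Omega -> R) by exact: bmf_indic.
rewrite ger0_norm ?mean_ge0//.
apply: (@le_trans _ _ (\int[P]_w (e / 2 + \1_A w))).
  apply: le_mean => //; [exact/bmf_norm/bmfB/bW/bK|by apply: bmfD => //; exact: bmf_cst|].
  move=> w; have := K01 n w mB; have := W01 w; rewrite indicE.
  case: (boolP (w \in A)) => /= [_|].
    by move=> /andP[? ?] /andP[? ?]; rewrite ler_norml; lra.
  rewrite notin_setE /A /= => /negP; rewrite -leNgt => KV _ /andP[k0 k1].
  rewrite addr0; apply: le_trans KV; rewrite /W.
  move: (kernel_mean _ _ _) k0 k1 (V w) => k k0 k1 v.
  have [v1|v1] := leP 1 v; first by rewrite max_r ?ler01// ler_norml ler0_norm; lra.
  have [v0|v0] := leP 0 v; first by [].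
  by rewrite ler_norml ger0_norm; lra.
rewrite meanD//; last exact: bmf_cst.
rewrite mean_cst// mean_indic// [leRHS]splitr lerD2l.
exact: le_trans (ler_norm _) Hn.
Qed.

Lemma l1_limit_onC B W : l1_limit_on B W ->
  l1_limit_on (~` B) (fun w => 1 - W w).
Proof.
move=> [mB bW H]; split; [exact: measurableC|by apply: bmfB => //; exact: bmf_cst|].
rewrite (_ : (fun n => _) =
  fun n => \int[P]_w `|kernel_mean (alpha_ n) \1_B w - W w|)//.
apply/funext => n; apply: eq_Rintegral => w _; rewrite !kernel_mean_indic//; last exact: measurableC.
rewrite -setTD fine_measureD//; last exact: prob_kernel.
by rewrite [in LHS]prob_kernel /= opprB addrCA (addrC 1) addrK distrC.
Qed.

Lemma l1_limit_onT : l1_limit_on setT (fun _ => 1).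
Proof.
split => //; first exact: bmf_cst.
rewrite (_ : (fun n => _) = fun _ => 0); first exact: cvg_cst.
apply/funext => n; rewrite -[RHS](mean_cst P1 0); apply: eq_Rintegral => w _.
by rewrite kernel_mean_indic// prob_kernel /= subrr normr0.
Qed.

Lemma l1_limit_on0 : l1_limit_on set0 (fun _ => 0).
Proof.
have := l1_limit_onC l1_limit_onT; rewrite setCT.
by under eq_fun do rewrite subrr.
Qed.

Lemma l1_limit_onU A B V W : A `&` B = set0 -> l1_limit_on A V ->
  l1_limit_on B W -> l1_limit_on (A `|` B) (fun w => V w + W w).
Proof.
move=> AB [mA bV HA] [mB bW HB]; have mAB := measurableU _ _ mA mB.
split => //; first exact: bmfD.
pose f n := \int[P]_w `|kernel_mean (alpha_ n) \1_A w - V w|.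
pose g n := \int[P]_w `|kernel_mean (alpha_ n) \1_B w - W w|.
apply: (@cvg0_le _ _ (fun n => f n + g n)); last first.
  by rewrite -[X in _ --> X](addr0 0); exact: cvgD.
move=> n; rewrite ger0_norm ?mean_ge0// /f /g.
apply: le_trans (mean_norm_triangle P1 (bmfB (bK n mA) bV) (bmfB (bK n mB) bW)).
apply: le_mean => //.
- exact/bmf_norm/bmfB/bmfD/bW/bV/bK.
- by apply/bmf_norm/bmfD; apply: bmfB => //; exact: bK.
move=> w; rewrite !kernel_mean_indic// fine_measureU// ?prob_kernel//.
by rewrite opprD addrACA.
Qed.

(** For nested sets the mass of the union is the larger mass, and the maximum is Lipschitz in its
    arguments. The versions [V] and [W] may be out of order on a null set; passing to the maximum
    gives limits that increase everywhere. *)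
Lemma l1_limit_on_max A B V W : A `<=` B \/ B `<=` A -> l1_limit_on A V ->
  l1_limit_on B W -> l1_limit_on (A `|` B) (fun w => Num.max (V w) (W w)).
Proof.
move=> AB [mA bV HA] [mB bW HB]; have mAB := measurableU _ _ mA mB.
have bM : bmf (fun w => Num.max (V w) (W w)).
  have [[mV [C VC]] [mW [D WD]]] := (bV, bW).
  split; first exact: measurable_maxr.
  exists (Num.max C D) => w; rewrite le_max.
  by case: (leP (V w) (W w)) => _; rewrite ?VC ?WD ?orbT.
split => //.
pose f n := \int[P]_w `|kernel_mean (alpha_ n) \1_A w - V w|.
pose g n := \int[P]_w `|kernel_mean (alpha_ n) \1_B w - W w|.
apply: (@cvg0_le _ _ (fun n => f n + g n)); last first.
  by rewrite -[X in _ --> X](addr0 0); exact: cvgD.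
move=> n; rewrite ger0_norm ?mean_ge0// /f /g.
have bKV := bmf_norm (bmfB (bK n mA) bV); have bKW := bmf_norm (bmfB (bK n mB) bW).
rewrite -meanD//; apply: le_mean => //.
- exact/bmf_norm/bmfB/bM/bK.
- exact: bmfD.
move=> w; rewrite !kernel_mean_indic//.
have -> : fine (alpha_ n w (A `|` B)) =
    Num.max (fine (alpha_ n w A)) (fine (alpha_ n w B)).
  have le A' B' : measurable A' -> measurable B' -> A' `<=` B' ->
      fine (alpha_ n w A') <= fine (alpha_ n w B').
    by move=> *; apply: fine_le_measure => //; exact: prob_kernel.
  by case: AB => AB; [rewrite (setUidr AB) max_r|rewrite (setUidl AB) max_l]; rewrite ?le.
move: (fine (alpha_ n w A)) (fine (alpha_ n w B)) (V w) (W w) => a b v u.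
have := ler_norm (a - v); have := ler_norm (v - a); rewrite (distrC v a).
have := ler_norm (b - u); have := ler_norm (u - b); rewrite (distrC u b).
move: `|a - v| `|b - u| => x y; rewrite ler_norml.
by case: (leP a b) => ?; case: (leP v u) => ? ? ? ? ?; lra.
Qed.

Hypothesis tight : forall B : nat -> set (borel S),
  (forall k, measurable (B k)) -> (forall k, B k.+1 `<=` B k) ->
  \bigcap_k B k = set0 -> forall e : R, 0 < e ->
  exists k, \forall n \near \oo, \int[P]_w \1_(B k) (X n w) <= e.

(** An exchange of the limits in [k] and [n], made possible by [tight]: the mean predictive mass of
    the remainder is the probability that [X n] falls in it, small for all large [n] with one [k].
    The other two thirds of [e] cover the convergence at that fixed [k] and the dominated
    convergence of [W_ k] to [W]. *)
Lemma l1_limit_on_bigcup (B : nat -> set (borel S)) W_ W C :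
  (forall k, B k `<=` B k.+1) -> (forall k, l1_limit_on (B k) (W_ k)) ->
  (forall k w, `|W_ k w| <= C) -> bmf W -> (forall w, W_ k w @[k --> \oo] --> W w) ->
  l1_limit_on (\bigcup_k B k) W.
Proof.
move=> Bi HW W_C bW W_W.
have mB k : measurable (B k) by have [] := HW k.
have mU : measurable (\bigcup_k B k) by exact: bigcupT_measurable.
split => //; apply/cvg0P => e e0; have e30 : 0 < e / 3 by rewrite divr_gt0.
pose D k := \bigcup_k B k `\` B k.
have mD k : measurable (D k) by exact: measurableD.
have Dd k : D k.+1 `<=` D k by move=> x [Ux Bx]; split => // /Bi.
have D0 : \bigcap_k D k = set0.
  apply/seteqP; split => // x Dx; have [[i _ Bi'] _] := Dx 0%N I.
  by have [_] := Dx i I; apply.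
have Dmono i j : (i <= j)%N -> D j `<=` D i.
  move=> ij; apply/subsetPset; have /nonincreasing_seqP : forall i, (D i >= D i.+1)%O.
    by move=> k; exact/subsetPset.
  exact.
have [k0 Hk0] := tight mD Dd D0 e30.
have bW_ k : bmf (W_ k) by have [] := HW k.
have bWW k : bmf (fun w => `|W_ k w - W w|) by exact/bmf_norm/bmfB.
have [CW WC] : exists C', forall w, `|W w| <= C' by case: bW.
have : \int[P]_w `|W_ k w - W w| @[k --> \oo] --> (0 : R).
  rewrite -[X in _ --> X](mean_cst P1 0).
  apply: (@mean_bounded_cvg _ _ _ _ _ _ (C + CW)) => //.
  - exact: bmf_cst.
  - move=> k w; rewrite normr_id (le_trans (ler_normB _ _))// lerD//.
  - move=> w; rewrite -(normr0 R) -(subrr (W w)); apply: cvg_norm.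
    by apply: cvgB => //; exact: cvg_cst.
move=> /cvg0P/(_ _ e30)[k1 _ Hk1]; pose k := maxn k0 k1.
have {}Hk1 := Hk1 k (leq_maxr _ _).
have [_ _ /cvg0P/(_ _ e30)] := HW k; apply: filterS2 Hk0 => n Hk0 Hn.
have bd : bmf (kernel_mean (alpha_ n) \1_(D k)) by exact: bK.
have bKW : bmf (fun w => `|kernel_mean (alpha_ n) \1_(B k) w - W_ k w|).
  exact/bmf_norm/bmfB/bW_/bK.
rewrite ger0_norm ?mean_ge0//.
apply: (@le_trans _ _ (\int[P]_w (kernel_mean (alpha_ n) \1_(D k) w +
   (`|kernel_mean (alpha_ n) \1_(B k) w - W_ k w| + `|W_ k w - W w|)))).
  apply: le_mean => //.
  - exact/bmf_norm/bmfB/bW/bK.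
  - by apply: bmfD => //; exact: bmfD.
  move=> w; rewrite !kernel_mean_indic// fine_measureD// ?prob_kernel//; last first.
    exact: bigcup_sup.
  have : fine (alpha_ n w (B k)) <= fine (alpha_ n w (\bigcup_k B k)).
    by apply: fine_le_measure => //; [exact: prob_kernel|exact: bigcup_sup].
  move: (fine (alpha_ n w (B k))) (fine (alpha_ n w (\bigcup_k B k))) (W_ k w) (W w)
    => b u v z bu.
  rewrite (_ : u - z = (u - b) + ((b - v) + (v - z))); last by lra.
  rewrite (le_trans (ler_normD _ _))// lerD ?ler_normD//.
  by rewrite ger0_norm ?subr_ge0.
rewrite meanD//; last exact: bmfD.
rewrite meanD// -(predictive_mean1 halpha); last exact: bmf_indic.
have : \int[P]_w \1_(D k) (X n w) <= e / 3.
  apply: le_trans Hk0; apply: le_mean => //.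
  - by apply: bmf_X; exact: bmf_indic.
  - by apply: bmf_X; exact: bmf_indic.
  have DD := Dmono _ _ (leq_maxl k0 k1).
  move=> w; rewrite !indicE; case: (boolP (X n w \in D k)) => [|_]; last exact: ler0n.
  by move=> /set_mem/DD/mem_set ->.
move: Hn Hk1; rewrite !ger0_norm ?mean_ge0//.
move: (Rintegral _ _ _) (Rintegral _ _ _) (Rintegral _ _ _) => p q r.
by move=> ? ? ?; lra.
Qed.

End limit_construction.

Lemma fine_cvg_measure_bigcup d (T : measurableType d) (R : realType)
    (mu : {measure set T -> \bar R}) (B : nat -> set T) : mu setT = 1%E ->
  (forall k, measurable (B k)) -> (forall k, B k `<=` B k.+1) ->
  fine (mu (B k)) @[k --> \oo] --> fine (mu (\bigcup_k B k)).
Proof.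
move=> mu1 mB Bi.
have mU : measurable (\bigcup_k B k) by exact: bigcupT_measurable.
suff /fine_cvgP[] : mu (B k) @[k --> \oo] --> (fine (mu (\bigcup_k B k)))%:E by [].
rewrite fineK ?prob_fin_num//; apply: nondecreasing_cvg_mu => //.
by apply/nondecreasing_seqP => n; exact/subsetPset.
Qed.

(** * Quantiles of a random distribution function given at countably many levels *)

Section quantile.
Context d (Omega : measurableType d) (R : realType).
Variables (q : nat -> R) (F : nat -> Omega -> R).
Hypothesis mF : forall i, measurable_fun setT (F i).
Hypothesis F01 : forall i w, 0 <= F i w <= 1.

(** Keeping the terms in [0, 2] makes their infimum a real number; the default 2 lies above [0, 1],
    the range of the coordinate [phi] in the application. *)
Let step i (z : Omega * R) : R :=
  if (0 <= q i <= 2) && (z.2 <= F i z.1) then q i else 2.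

(* The infimum of the [q i] in [0, 2] such that [u <= F i w], and [2] if there
   is none: the quantile function of the random distribution function with
   value [F i] at [q i]. *)
Definition quantile (z : Omega * R) : R := infs (step ^~ z) 0.

Let step_ge0 i z : 0 <= step i z.
Proof. by rewrite /step; case: ifPn => // /andP[/andP[]]. Qed.

Let step_lb z : has_lbound (range (step ^~ z)).
Proof. by exists 0 => _ [i _ <-]; exact: step_ge0. Qed.

Lemma measurable_quantile : measurable_fun setT quantile.
Proof.
apply: measurable_fun_infs => [z _|i]; first exact: step_lb.
apply: measurable_fun_ifT; [|exact: measurable_cst|exact: measurable_cst].
apply: measurable_and; first exact: measurable_cst.
apply: measurable_fun_ler; first exact: measurable_snd.
exact: measurableT_comp (mF i) measurable_fst.
Qed.

Let quantile_lt t z : quantile z < t <-> exists i, step i z < t.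
Proof.
have := infs_preimage t 0 (fun z (_ : setT z) => step_lb z).
rewrite !setTI => /seteqP[H1 H2]; split.
  move=> qt; have [|i _] := H1 z; first by rewrite /= in_itv.
  by rewrite /= in_itv /= => it; exists i.
move=> [i it]; have := H2 z; rewrite /= in_itv /=; apply; exists i => //=. 
Qed.

Lemma quantile_le2 z : quantile z <= 2.
Proof.
rewrite leNgt; apply/negP => H.
have [_] := quantile_lt (quantile z) z.
have : step 0%N z <= 2 by rewrite /step; case: ifPn => // /andP[/andP[]].
by move=> h0 /(_ (ex_intro _ 0%N (le_lt_trans h0 H))); rewrite ltxx.
Qed.

Lemma quantile_ltP t w u : t <= 2 ->
  quantile (w, u) < t <-> exists i, 0 <= q i < t /\ u <= F i w.
Proof.
move=> t2; rewrite quantile_lt; split=> -[i]; rewrite /step /=.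
  case: ifPn => [/andP[/andP[q0 q2] uF] qt|_]; last by rewrite ltNge t2.
  by exists i; rewrite q0.
move=> [/andP[q0 qt] uF]; exists i.
by rewrite q0 uF (le_trans (ltW qt) t2).
Qed.

Variable t : R.

(* The first [k] levels below [t] give an increasing approximation of
   [quantile < t], of mass [max_level k]. *)
Fixpoint sup_point k : R := if k is i.+1 then
  if 0 <= q i < t then Num.max (sup_point i) (q i) else sup_point i else 0.

Fixpoint max_level k (w : Omega) : R := if k is i.+1 then
  if 0 <= q i < t then Num.max (max_level i w) (F i w) else max_level i w else 0.

Let lower_set k w : set R := [set u | exists2 i, (i < k)%N & 0 <= q i < t /\ u <= F i w].

Lemma max_level01 k w : 0 <= max_level k w <= 1.
Proof.
elim: k => [|k IH] /=; first by rewrite lexx ler01.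
by case: ifP => // _; have := F01 k w; rewrite le_max ge_max; lra.
Qed.

Let lower_setS k w : lower_set k.+1 w = lower_set k w `|`
  (if 0 <= q k < t then [set u | u <= F k w] else set0).
Proof.
apply/seteqP; split => u /=.
  move=> [i]; rewrite ltnS leq_eqVlt => /orP[/eqP ->|ik] [qt uF].
    by right; rewrite qt.
  by left; exists i.
move=> [[i ik H]|]; first by exists i => //; exact: ltnW.
by case: ifPn => // qt uF; exists k.
Qed.

(** With no admissible level among the first [k] the set is empty and not the ray below 0; both have
    mass 0 under the uniform law, so [lam_lower_set] holds in either case. *)
Let lower_setP k w : (lower_set k w = set0 /\ max_level k w = 0) \/
  lower_set k w = [set u | u <= max_level k w].
Proof.
elim: k => [|k IH].
  by left; split => //; apply/seteqP; split => // u [i].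
rewrite lower_setS /=; case: ifPn => [_|_]; last by rewrite setU0.
right; case: IH => [[-> ->]|->].
  by rewrite set0U max_r//; have /andP[] := F01 k w.
by apply/seteqP; split => u /=; rewrite le_max; move/orP.
Qed.

Lemma measurable_lower_set k w : measurable (lower_set k w).
Proof.
case: (lower_setP k w) => [[-> _]|->]; first exact: measurable0.
rewrite (_ : [set u | _] = `]-oo, max_level k w]%classic); first exact: measurable_itv.
by apply/seteqP; split => u /=; rewrite in_itv.
Qed.

Let lam : probability _ R := uniform_prob (@ltr01 R).

Let lam_lower_set k w : lam (lower_set k w) = (max_level k w)%:E.
Proof.
case: (lower_setP k w) => [[-> ->]|->]; first exact: measure0.
by apply: uniform_prob_ray; exact: max_level01.
Qed.

Lemma max_level_cvg w : t <= 2 -> max_level k w @[k --> \oo] -->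
  fine (image_kernel lam measurable_quantile w `]-oo, t[%classic).
Proof.
move=> t2.
have -> : image_kernel lam measurable_quantile w `]-oo, t[%classic =
    lam (\bigcup_k lower_set k w).
  rewrite image_kernelE; congr (lam _).
  apply/seteqP; split => u /=; rewrite in_itv /=.
    by move/(quantile_ltP _ _ t2) => [i H]; exists i.+1 => //; exists i.
  by move=> [k _ [i _ H]]; apply/(quantile_ltP _ _ t2); exists i.
rewrite (_ : (fun k => _) = fun k => fine (lam (lower_set k w))); last first.
  by apply/funext => k; rewrite lam_lower_set.
apply: fine_cvg_measure_bigcup => [|k|k].
- exact: probability_setT.
- exact: measurable_lower_set.
- by rewrite lower_setS; exact: subsetUl.
Qed.

(** The first alternative accounts for the starting value 0, which may exceed [t]; it is harmless
    because a nonnegative coordinate never falls below it. *)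
Lemma sup_pointP k : sup_point k <= 0 \/ sup_point k < t.
Proof.
elim: k => [|k IH] /=; first by left.
case: ifPn => // /andP[_ qt]; rewrite maxEle; case: ifP => // _.
by right.
Qed.

Lemma sup_pointS k : sup_point k <= sup_point k.+1.
Proof. by rewrite /=; case: ifP => // _; rewrite le_max lexx. Qed.

End quantile.

(** * Existence of the limit kernel *)

Section limit_kernel.
Context (R : realType) (S : ptopologicalType) (hS : standard_borel_space R S).
Context d (Omega : measurableType d) (P : probability Omega R).
Variables (X : nat -> {RV P >-> borel S}).
Variables (alpha_ : nat -> R.-pker Omega ~> borel S).
Hypothesis halpha : predictive_distributions X alpha_.

Lemma exists_l1_limit :
  (forall B : set (borel S), measurable B -> exists V : {RV P >-> R},
     cvg_in_probability (fun n => kernel_mean (alpha_ n) \1_B) V) ->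
  exists alpha : R.-pker Omega ~> borel S, l1_limit P alpha_ alpha.
Proof.
move=> hV.
have hW B (mB : measurable B) : exists2 W, l1_limit_on P alpha_ B W &
    forall w, 0 <= W w <= 1.
  by have [V HV] := hV B mB; exact: l1_limit_on_clamp HV.
have tight := law_cvg_tight (X := X)
  (fun B mB => let: ex_intro2 W (And3 _ bW HW) _ := hW B mB in
    l1_cvg_law halpha mB bW HW).
have [phi [psi [mphi phi01 mpsi phiK]]] := standard_borel_retract hS.
pose A t : set (borel S) := phi @^-1` `]-oo, t[.
have mA t : measurable (A t).
  by rewrite -[X in measurable X]setTI; exact: mphi.
(* Integers that encode no rational merely repeat the level 0. *)
pose q i : R := if unpickle i is Some r then ratr (r : rat) else 0.
have hF i : exists F, l1_limit_on P alpha_ (A (q i)) F /\ forall w, 0 <= F w <= 1.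
  by have [F HF F01] := hW _ (mA (q i)); exists F.
have [F HF] := choice hF.
have F01 i w : 0 <= F i w <= 1 by have [] := HF i.
have mF i : measurable_fun setT (F i) by have [[_ []]] := HF i.
pose lam : probability _ R := uniform_prob (@ltr01 R).
pose beta := image_kernel lam (measurable_quantile q mF).
pose V C w := fine (beta w C).
have bV C : measurable C -> bmf (V C).
  move=> mC; rewrite (_ : V C = kernel_mean beta \1_C).
    by apply: bmf_kernel_mean; exact: bmf_indic.
  by apply/funext => w; rewrite kernel_mean_indic.
have V01 C w : measurable C -> `|V C w| <= 1.
  move=> mC; rewrite ger0_norm ?fine_ge0//.
  have := fine_le_measure (prob_kernel (s := beta) w) mC measurableT (@subsetT _ C).
  by rewrite prob_kernel.
have VU C D w : measurable C -> measurable D -> C `&` D = set0 ->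
    V (C `|` D) w = V C w + V D w.
  by move=> mC mD CD; apply: fine_measureU => //; exact: prob_kernel.
(* It is enough to work on the line: if [C] is the preimage of [B] under [psi], pulling it back by
   [phi] gives [B] again, and [V C] is the mass of [B] under the law of [psi] of the quantile. *)
suff HV C : measurable C -> l1_limit_on P alpha_ (phi @^-1` C) (V C).
  pose alpha := image_kernel lam
    (measurableT_comp mpsi (measurable_quantile q mF)).
  exists alpha => B mB.
  have mpB : measurable (psi @^-1` B).
    by rewrite -[X in measurable X]setTI; apply: (mpsi measurableT).
  have [_ _] := HV _ mpB; rewrite -comp_preimage.
  rewrite (_ : (psi \o phi) @^-1` B = B); last first.
    by apply/seteqP; split => x /=; rewrite phiK.
  rewrite (_ : (fun n => _) = fun n => \int[P]_w
    `|kernel_mean (alpha_ n) \1_B w - kernel_mean alpha \1_B w|)//.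
  by apply/funext => n; apply: eq_Rintegral => w _; rewrite [kernel_mean alpha _ _]kernel_mean_indic.
have RE : @measurable _ R = <<s @RGenInftyO.G R >> := RGenInftyO.measurableE R.
rewrite RE; move: C; apply: (dynkin_induction RE).
- move=> _ _ [s ->] [t ->]; exists (Num.min s t).
  by apply/seteqP; split => x /=; rewrite !in_itv/= lt_min => /andP.
- rewrite preimage_setT (_ : V setT = fun _ => 1); first exact: l1_limit_onT.
  by apply/funext => w; rewrite /V prob_kernel.
- move=> _ [t ->]; rewrite -/(A t).
  (* Beyond 2 both masses are 1, since [phi] is at most 1 and the quantile at most 2. *)
  have [t2|t2] := ltP 2 t.
    rewrite (_ : A t = setT); last first.
      apply/seteqP; split => // x _; rewrite /A /= in_itv /=.
      by have := phi01 x; lra.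
    rewrite (_ : V _ = fun _ => 1); first exact: l1_limit_onT.
    apply/funext => w; rewrite /V image_kernelE (_ : [set u | _] = setT).
      by rewrite probability_setT.
    apply/seteqP; split => // u _ /=; rewrite in_itv /=.
    exact: le_lt_trans (quantile_le2 _ _ _) t2.
  have -> : A t = \bigcup_k A (sup_point q t k).
    apply/seteqP; split => x; rewrite /A /= ?in_itv/=.
      move=> /rat_in_itvoo[r]; rewrite in_itv /= => /andP[xr rt].
      have x0 : 0 <= phi x by have /andP[] := phi01 x.
      exists (pickle r).+1 => //; rewrite /= in_itv /= /q pickleK rt.
      by rewrite (le_trans x0 (ltW xr)) /= lt_max xr orbT.
    move=> [k _ /=]; rewrite in_itv /= => xk.
    have [k0|] := sup_pointP q t k; last exact: lt_trans.
    by have := phi01 x; lra.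
  apply: (l1_limit_on_bigcup halpha tight (C := 1) (W_ := max_level q F t)).
  + move=> k x; rewrite /A /= !in_itv /= => xk.
    exact: lt_le_trans xk (sup_pointS q t k).
  + elim=> [|k IH].
      rewrite (_ : A _ = set0); first exact: l1_limit_on0.
      apply/seteqP; split => // x; rewrite /A /= in_itv /=.
      by have := phi01 x; lra.
    rewrite /=; case: ifPn => // _.
    rewrite (_ : A (Num.max _ _) = A (sup_point q t k) `|` A (q k)); last first.
      by apply/seteqP; split => x; rewrite /A /= !in_itv /= lt_max => /orP.
    apply: l1_limit_on_max => //; last by have [] := HF k.
    have [le|/ltW le] := leP (sup_point q t k) (q k); [left|right];
      move=> x; rewrite /A /= !in_itv /= => H; exact: lt_le_trans H le.
  + by move=> k w; have /andP[? ?] := max_level01 q F01 t k w; rewrite ger0_norm.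
  + by apply: bV; exact: measurable_itv.
  + by move=> w; exact: max_level_cvg.
- move=> C mC HC; rewrite preimage_setC.
  rewrite (_ : V _ = fun w => 1 - V C w); first exact: l1_limit_onC.
  apply/funext => w; rewrite /V -setTD fine_measureD; last 4 first.
  + exact: prob_kernel.
  + exact: measurableT.
  + exact: mC.
  + exact: subsetT.
  by congr (_ - _); exact: (congr1 fine (prob_kernel (s := beta) w)).
- move=> C mC trC HC.
  pose B k := \big[setU/set0]_(i < k) C i.
  have mB k : measurable (B k) by exact: bigsetU_measurable.
  have BS k : B k.+1 = B k `|` C k by rewrite /B big_ord_recr.
  have BC : \bigcup_k C k = \bigcup_k B k.
    apply/seteqP; split => x.
      by move=> [k _ Ck]; exists k.+1 => //; rewrite BS; right.
    by move=> [k _]; exact: bigsetU_bigcup.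
  rewrite BC preimage_bigcup.
  apply: (l1_limit_on_bigcup halpha tight (C := 1) (W_ := fun k => V (B k))).
  + by move=> k x; rewrite /= BS; left.
  + elim=> [|k IH].
      rewrite /B big_ord0 preimage_set0 (_ : V set0 = fun _ => 0).
        exact: l1_limit_on0.
      by apply/funext => w; rewrite /V measure0.
    rewrite BS preimage_setU.
    have BCk : B k `&` C k = set0.
      apply/seteqP; split => // x []; rewrite /B -bigcup_mkord => -[i /= ik Ci] Ck.
      suff E : i = k by rewrite E ltnn in ik.
      by apply: trC => //; exists x.
    rewrite (_ : V _ = fun w => V (B k) w + V (C k) w); last first.
      by apply/funext => w; rewrite VU.
    apply: (l1_limit_onU _ IH (HC k)).
    by rewrite -preimage_setI BCk preimage_set0.
  + by move=> k w; exact: V01.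
  + by apply: bV; exact: bigcupT_measurable.
  + move=> w; apply: fine_cvg_measure_bigcup => //; first exact: prob_kernel.
    by move=> k; rewrite BS; exact: subsetUl.
Qed.

End limit_kernel.

Theorem theorem3 (R : realType) (S : ptopologicalType)
    (hS : standard_borel_space R S)
    (d : measure_display) (Omega : measurableType d) (P : probability Omega R)
    (X : nat -> {RV P >-> borel S})
    (alpha_ : nat -> R.-pker Omega ~> borel S)
    (halpha : predictive_distributions X alpha_) :
  (forall f : borel S -> R, measurable_fun [set: borel S] f -> bounded_fun f ->
     exists V : {RV P >-> R},
       cvg_in_probability (fun n => kernel_mean (alpha_ n) f) V)
  <->
  ((forall B : set (borel S), measurable B ->
      cvg (P (X n @^-1` B) @[n --> \oo])) /\
   exists alpha : R.-pker Omega ~> borel S,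
     cvg_stably X alpha /\
     forall f : S -> R, continuous f -> bounded_fun f ->
       'E_P[(fun w => kernel_mean (alpha_ n) f w ^+ 2)%R]%E @[n --> \oo]
         --> 'E_P[(fun w => kernel_mean alpha f w ^+ 2)%R]%E).
Proof.
split=> [hV|[hcvg [alpha [hst hsq]]]].
  have [alpha la] : exists alpha : R.-pker Omega ~> borel S, l1_limit P alpha_ alpha.
    apply: (exists_l1_limit hS halpha) => B mB.
    have bB : bmf (\1_B : borel S -> R) by exact: bmf_indic.
    by apply: hV; [have [] := bB|exact: bmf_bounded].
  split=> [B mB|].
    apply: (l1_cvg_law halpha mB _ (la B mB)).
    by apply: bmf_kernel_mean; exact: bmf_indic.
  exists alpha; split; first exact: (l1_limit_stable halpha).
  move=> f cf bf; apply: l1_limit_cvg_sqr => //.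
  by apply: (@bmfP _ (borel S) R f) => //; exact: continuous_borel_measurable.
move=> f mf bf; have bmf_f : bmf f by exact: bmfP.
apply: (@l1_limit_cvg_probability _ _ _ _ _ _ alpha) => //.
exact: (stable_l1_limit halpha (standard_borel_cozero hS)).
Qed.
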